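(* Let $N,k\in\mathbb N$ and $\tau>0$, and let $U\sim\mathrm U(N)$ denote the Haar measure. Then the query complexity of non-trivial learning states $\rho(U)=U|0\rangle\langle0|U^\dagger$ with respect to $U\sim\mathrm U(N)$ from $k$-copy quantum statistical queries satisfies $$q_{\mathrm{nt}}\big[(\mathbb S^{N-1})^{\odot k},\tau\big]\ge\exp\left(\frac{N\tau^2}{9\pi^3k^2}\right).$$
   Context: The $k$-copy oracle $\mathtt{QStat}^{(k)}_\tau(\rho)$, queried with a Hermitian $O$ on $(\mathbb C^N)^{\otimes k}$ with $\|O\|_{\mathrm{op}}\le1$, returns some $v$ with $|v-\mathrm{tr}[\rho^{\otimes k}O]|\le\tau$. The query complexity of non-trivial learning is $q_{\mathrm{nt}}[(\mathbb S^{N-1})^{\odot k},\tau]=\sup_g\big(\sup_O\Pr_{U\sim\mathrm U(N)}[|\mathrm{tr}[\rho(U)^{\otimes k}O]-g(O)|>\tau]\big)^{-1}$, where $O$ ranges over Hermitian operators on $(\mathbb C^N)^{\otimes k}$ with $\|O\|_{\mathrm{op}}\le1$ and $g$ over real-valued functions on that set. *)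

(* Defs.v *)
From HB Require Import structures.
From mathcomp Require Import all_boot all_order all_algebra.
From mathcomp Require Import all_classical all_reals all_analysis.
From mathcomp Require Import complex mxtens.
Set Implicit Arguments. Unset Strict Implicit. Unset Printing Implicit Defensive.
Import Order.TTheory GRing.Theory Num.Theory.
Local Open Scope classical_set_scope.
Local Open Scope ring_scope.

Section QStat.
Variable R : realType.
Local Notation C := R[i].

Definition adjmx m n (A : 'M[C]_(m, n)) : 'M[C]_(n, m) :=
  \matrix_(i, j) conjc (A j i).

Definition hermitian n (O : 'M[C]_n) : Prop := adjmx O = O.
Definition unitary n (U : 'M[C]_n) : Prop := adjmx U *m U = 1%:M.

Definition vnorm2 n (v : 'cV[C]_n) : R := \sum_i (ComplexField.Normc.normc (v i 0)) ^+ 2.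

Definition opnorm_le1 n (O : 'M[C]_n) : Prop :=
  forall v : 'cV[C]_n, vnorm2 (O *m v) <= vnorm2 v.

Definition admissible n (O : 'M[C]_n) : Prop := hermitian O /\ opnorm_le1 O.

Definition ket0 N : 'cV[C]_N := \col_i ((i : nat) == 0%N)%:R.

Definition rhoU N (U : 'M[C]_N) : 'M[C]_N :=
  U *m (@ket0 N *m adjmx (@ket0 N)) *m adjmx U.

(* the type of N x N complex matrices, equipped with a point (needed for
   the generated sigma-algebra) *)
Definition CMat N : Type := 'M[C]_N.
HB.instance Definition _ N := Choice.on (CMat N).
HB.instance Definition _ N := isPointed.Build (CMat N) (0%R : 'M[C]_N).

(* Borel sigma-algebra on N x N complex matrices (= product Borel on R^(2N^2)),
   generated by the real and imaginary parts of the entries *)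
Definition entry_sets N : set (set (CMat N)) :=
  [set A | exists (i j : 'I_N) (B : set R), measurable B /\
     (A = (fun M : CMat N => complex.Re (M i j)) @^-1` B \/
      A = (fun M : CMat N => complex.Im (M i j)) @^-1` B)].

End QStat.

Notation MatMeas R N := (g_sigma_algebraType (@entry_sets R N)).

Section QStat2.
Variable R : realType.
Local Notation C := R[i].

(* mu is the Haar probability measure on U(N): supported on unitaries and
   left-invariant under U(N) (this characterizes Haar measure uniquely) *)
Definition is_haar N (mu : probability (MatMeas R N) R) : Prop :=
  mu [set U : MatMeas R N | unitary U] = 1%E /\
  forall V : 'M[C]_N, unitary V ->
    forall A : set (MatMeas R N), measurable A ->
      mu ((fun U : MatMeas R N => (V *m U : MatMeas R N)) @^-1` A) = mu A.

Definition fail_event N k (tau : R) (g : 'M[C]_(N ^ k) -> R)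
    (O : 'M[C]_(N ^ k)) : set (MatMeas R N) :=
  [set U | tau < ComplexField.Normc.normc (\tr (ntensmx (rhoU U) k *m O) - ((g O)%:C)%C)].

(* q_nt[(S^{N-1})^{odot k}, tau] =
     sup_g ( sup_O Pr_U[ |tr[rho(U)^{(x)k} O] - g(O)| > tau ] )^{-1}
   in the extended reals (1/0 = +oo) *)
Definition q_nt N k (tau : R) (mu : probability (MatMeas R N) R) : \bar R :=
  ereal_sup [set (inve (ereal_sup [set mu (@fail_event N k tau g O) |
                                    O in [set O | admissible O]]))
            | g in [set: 'M[C]_(N ^ k) -> R]].

End QStat2.

(* Main.v *)
Require Import Defs.
From HB Require Import structures.
From mathcomp Require Import all_boot all_order all_algebra.
From mathcomp Require Import all_classical all_reals all_analysis.
From mathcomp Require Import measurable_realfun complex mxtens.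
From mathcomp Require Import ring lra zify.
Set Implicit Arguments. Unset Strict Implicit. Unset Printing Implicit Defensive.
Import Order.TTheory GRing.Theory Num.Theory.
Local Open Scope classical_set_scope.
Local Open Scope ring_scope.
Local Arguments conjc : simpl never.

(** Write [z] for the first column of [U], a random point of the unit sphere, and
    [f z = <z^k | O | z^k>].  Left invariance of the Haar measure gives, for polynomials
    [G_p] in [z] and [conj z], the integration by parts formula
    [E sum_p dG_p/dz_p = E (N sum_p conj z_p G_p + sum_pq conj z_p conj z_q dG_p/d(conj z_q))].
    Let [h_m] be the image of [f] under the [m]-th power of [sum_p d^2/(dz_p d(conj z_p))];
    it is the sum of [<D z^k | O | D z^k>] over the holomorphic derivatives [D] of order [m].
    Since the corresponding sum of [|D z^k|^2] is [c_m |z|^(2(k-m))], with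
    [c_m = prod_(i < m) (k-i) (N+k-i-1)], the operator norm bound on [O] yields
    [|grad h_m| <= c_m (k-m)] on the sphere.  Integrating by parts against powers of
    [Y = f - h_k / c_k] ([h_k] is constant) and telescoping [h_m / c_m] over [m] gives
    [E Y^(l+2) <= (l+1) (k^2/N) E Y^l] for even [l], hence a Gaussian tail
    [P (|Y| > t) <= 2 exp (- N t^2 / (4 k^2))].  When [N t^2 / k^2] is large this
    beats the target with [g O = h_k / c_k]; otherwise Chebyshev confines [f] to an
    interval of length [O (k / sqrt N)], and among the intervals of length [2 tau]
    covering it one carries enough mass, so [g O] is its midpoint. *)

(** * The complex modulus as a real number *)

Section ComplexModulus.
Variable R : realType.
Local Notation C := R[i].
Implicit Types x y : C.

Definition cmod x : R := ComplexField.Normc.normc x.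

Lemma cmod_norm x : (cmod x)%:C%C = `|x|.
Proof. by []. Qed.

Lemma cmod_ge0 x : 0 <= cmod x.
Proof. by rewrite -ler0c cmod_norm normr_ge0. Qed.

Lemma cmodM x y : cmod (x * y) = cmod x * cmod y.
Proof. exact: ComplexField.Normc.normcM. Qed.

Lemma cmodD x y : cmod (x + y) <= cmod x + cmod y.
Proof. by rewrite -lecR rmorphD /= !cmod_norm ler_normD. Qed.

Lemma cmod0 : cmod 0 = 0.
Proof. exact: ComplexField.Normc.normc0. Qed.

Lemma cmod0_eq0 x : cmod x = 0 -> x = 0.
Proof. exact: ComplexField.Normc.eq0_normc. Qed.

Lemma cmodN x : cmod (- x) = cmod x.
Proof. by apply: complexI; rewrite !cmod_norm normrN. Qed.

Lemma cmodJ x : cmod (conjc x) = cmod x.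
Proof. by apply: complexI; rewrite !cmod_norm normcJ. Qed.

Lemma cmod_real (r : R) : cmod (r%:C)%C = `|r|.
Proof. by rewrite /cmod /= expr0n /= addr0 sqrtr_sqr. Qed.

Lemma cmod_sum (I : Type) (s : seq I) (F : I -> C) :
  cmod (\sum_(i <- s) F i) <= \sum_(i <- s) cmod (F i).
Proof.
elim: s => [|i s IHs]; first by rewrite !big_nil cmod0.
by rewrite !big_cons (le_trans (cmodD _ _)) // lerD2l.
Qed.

Lemma cmod_sqr x : ((cmod x ^+ 2)%:C)%C = x * conjc x.
Proof. by rewrite rmorphXn /= cmod_norm sqr_normc. Qed.

Lemma Re_le_cmod x : complex.Re x <= cmod x.
Proof.
rewrite (le_trans (ler_norm _)) // -lecR cmod_norm; exact: normc_ge_Re.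
Qed.

(** Stands in for a limit: dividing by [s] and letting it shrink kills [x]. Derivatives are later
    read off from first-order estimates in this way. *)
Lemma small_quadratic_eq0 (x : C) (K : R) :
  (forall s : R, 0 < s <= 1 -> cmod ((s%:C)%C * x) <= K * s ^+ 2) -> x = 0.
Proof.
move=> h; apply: cmod0_eq0; apply/eqP; rewrite eq_le cmod_ge0 andbT.
have h' s : 0 < s <= 1 -> cmod x <= K * s.
  move=> /[dup] /andP[s0 _] /h; rewrite cmodM cmod_real gtr0_norm // expr2.
  by rewrite mulrCA ler_pM2l.
have K0 : 0 <= K by rewrite (le_trans (cmod_ge0 x)) // -[K]mulr1 h' // ltr01 lexx.
case: (ltP 0 (cmod x)) => // x0.
have Kx : 0 < K + cmod x by rewrite ltr_wpDl.
(* This [s] is at most 1 and makes [K * s] smaller than [cmod x]. *)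
have hs : 0 < cmod x / (2 * (K + cmod x)) <= 1.
  rewrite divr_gt0 ?mulr_gt0 //= ler_pdivrMr ?mulr_gt0 // mul1r; lra.
have := h' _ hs; rewrite mulrA ler_pdivlMr ?mulr_gt0 // => {}hs.
have : 0 <= K * cmod x by rewrite mulr_ge0 ?cmod_ge0.
nra.
Qed.

End ComplexModulus.

(** * Polynomials in [z] and its conjugate, Wirtinger derivatives and Taylor estimates *)

Section Polynomials.
Variables (R : realType) (N : nat).
Local Notation C := R[i].
Implicit Types (z d : 'cV[C]_N).

(* Polynomials in [z] ([Zvar]) and its conjugate ([Wvar]), kept as syntax so that the
   Wirtinger derivatives [dz] and [dw] are computed structurally. *)
Inductive cpoly : Type :=
| Cst of C
| Zvar of 'I_N
| Wvar of 'I_N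
| Add of cpoly & cpoly
| Mul of cpoly & cpoly.

Implicit Types e : cpoly.

Fixpoint peval e z : C :=
  match e with
  | Cst c => c
  | Zvar p => z p 0
  | Wvar p => conjc (z p 0)
  | Add a b => peval a z + peval b z
  | Mul a b => peval a z * peval b z
  end.

Fixpoint dz (p : 'I_N) e : cpoly :=
  match e with
  | Cst _ => Cst 0
  | Zvar q => Cst (p == q)%:R
  | Wvar _ => Cst 0
  | Add a b => Add (dz p a) (dz p b)
  | Mul a b => Add (Mul (dz p a) b) (Mul a (dz p b))
  end.

Fixpoint dw (p : 'I_N) e : cpoly :=
  match e with
  | Cst _ => Cst 0
  | Zvar _ => Cst 0
  | Wvar q => Cst (p == q)%:R
  | Add a b => Add (dw p a) (dw p b)
  | Mul a b => Add (Mul (dw p a) b) (Mul a (dw p b))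
  end.

Fixpoint cj e : cpoly :=
  match e with
  | Cst c => Cst (conjc c)
  | Zvar p => Wvar p
  | Wvar p => Zvar p
  | Add a b => Add (cj a) (cj b)
  | Mul a b => Mul (cj a) (cj b)
  end.

Fixpoint holo e : bool :=
  match e with
  | Wvar _ => false
  | Add a b | Mul a b => holo a && holo b
  | _ => true
  end.

Lemma peval_cj e z : peval (cj e) z = conjc (peval e z).
Proof.
elim: e => [c|p|p|a IHa b IHb|a IHa b IHb] //=; first by rewrite conjcK.
- by rewrite IHa IHb rmorphD.
- by rewrite IHa IHb rmorphM.
Qed.

Lemma dz_cj p e : dz p (cj e) = cj (dw p e).
Proof.
by elim: e => [c|q|q|a IHa b IHb|a IHa b IHb] //=;
  rewrite ?conjc0 ?conjc_nat ?IHa ?IHb.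
Qed.

Lemma dw_cj p e : dw p (cj e) = cj (dz p e).
Proof.
by elim: e => [c|q|q|a IHa b IHb|a IHa b IHb] //=;
  rewrite ?conjc0 ?conjc_nat ?IHa ?IHb.
Qed.

Lemma holo_dz p e : holo e -> holo (dz p e).
Proof.
elim: e => [c|q|q|a IHa b IHb|a IHa b IHb] //= /andP[ha hb];
  by rewrite ?IHa ?IHb ?ha ?hb.
Qed.

Lemma holo_dw p e z : holo e -> peval (dw p e) z = 0.
Proof.
elim: e => [c|q|q|a IHa b IHb|a IHa b IHb] //= /andP[ha hb];
  by rewrite IHa // IHb // ?addr0 // mul0r mulr0 addr0.
Qed.

Lemma holo_dzdw p q e z : holo e -> peval (dz q (dw p e)) z = 0.
Proof.
elim: e => [c|r|r|a IHa b IHb|a IHa b IHb] //= /andP[ha hb].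
  by rewrite IHa // IHb // addr0.
by rewrite IHa // IHb // !holo_dw // !(mul0r, mulr0, addr0).
Qed.

Lemma dzC p q e z : peval (dz p (dz q e)) z = peval (dz q (dz p e)) z.
Proof.
elim: e => [c|r|r|a IHa b IHb|a IHa b IHb] //=; first by rewrite IHa IHb.
by rewrite IHa IHb; ring.
Qed.

Lemma dwC p q e z : peval (dw p (dw q e)) z = peval (dw q (dw p e)) z.
Proof.
elim: e => [c|r|r|a IHa b IHb|a IHa b IHb] //=; first by rewrite IHa IHb.
by rewrite IHa IHb; ring.
Qed.

Definition Sum (I : Type) (s : seq I) (F : I -> cpoly) : cpoly :=
  foldr (fun i a => Add (F i) a) (Cst 0) s.

Lemma peval_Sum (I : Type) (s : seq I) F z :
  peval (Sum s F) z = \sum_(i <- s) peval (F i) z.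
Proof. by elim: s => [|i s IHs] /=; rewrite ?big_nil // big_cons IHs. Qed.

Lemma dz_Sum (I : Type) (s : seq I) F p :
  dz p (Sum s F) = Sum s (fun i => dz p (F i)).
Proof. by elim: s => [|i s IHs] //=; rewrite IHs. Qed.

Lemma dw_Sum (I : Type) (s : seq I) F p :
  dw p (Sum s F) = Sum s (fun i => dw p (F i)).
Proof. by elim: s => [|i s IHs] //=; rewrite IHs. Qed.

Definition Pow e n : cpoly := iter n (Mul e) (Cst 1).

Lemma peval_Pow e n z : peval (Pow e n) z = peval e z ^+ n.
Proof. by elim: n => [|n IHn] //=; rewrite exprS IHn. Qed.

Lemma peval_dz_Pow p e n z :
  peval (dz p (Pow e n)) z = n%:R * peval e z ^+ n.-1 * peval (dz p e) z.
Proof.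
elim: n => [|n IHn] /=; first by rewrite mul0r mul0r.
rewrite IHn peval_Pow; case: n {IHn} => [|n] /=; first by rewrite expr0; ring.
by rewrite exprS -[n.+2%:R]natr1; ring.
Qed.

Lemma peval_dw_Pow p e n z :
  peval (dw p (Pow e n)) z = n%:R * peval e z ^+ n.-1 * peval (dw p e) z.
Proof.
elim: n => [|n IHn] /=; first by rewrite mul0r mul0r.
rewrite IHn peval_Pow; case: n {IHn} => [|n] /=; first by rewrite expr0; ring.
by rewrite exprS -[n.+2%:R]natr1; ring.
Qed.

(** The real directional derivative at [z]: when [z] moves along [d], its conjugate moves along the
    conjugate of [d]. *)
Definition dirD d e z : C :=
  \sum_p (d p 0 * peval (dz p e) z + conjc (d p 0) * peval (dw p e) z).

Lemma dirD_Add d a b z : dirD d (Add a b) z = dirD d a z + dirD d b z.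
Proof. by rewrite -big_split /=; apply: eq_bigr => p _ /=; ring. Qed.

Lemma dirD_Mul d a b z :
  dirD d (Mul a b) z = dirD d a z * peval b z + peval a z * dirD d b z.
Proof.
by rewrite mulr_suml mulr_sumr -big_split /=; apply: eq_bigr => p _ /=; ring.
Qed.

Lemma dirD_Cst d c z : dirD d (Cst c) z = 0.
Proof. by rewrite /dirD big1 // => p _ /=; rewrite !mulr0 addr0. Qed.

Lemma dirD_Zvar d q z : dirD d (Zvar q) z = d q 0.
Proof.
rewrite /dirD (bigD1 q) //= eqxx mulr1 mulr0 addr0 big1 ?addr0 // => p pq.
by rewrite (negPf pq) !mulr0 addr0.
Qed.

Lemma dirD_Wvar d q z : dirD d (Wvar q) z = conjc (d q 0).
Proof.
rewrite /dirD (bigD1 q) //= eqxx mulr1 mulr0 add0r big1 ?addr0 // => p pq.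
by rewrite (negPf pq) !mulr0 addr0.
Qed.

Definition cbounded (B : R) z := forall p, cmod (z p 0) <= B.

Lemma peval_bounded e B :
  exists2 K, 0 <= K & forall z, cbounded B z -> cmod (peval e z) <= K.
Proof.
elim: e => [c|p|p|a [Ka Ka0 ha] b [Kb Kb0 hb]|a [Ka Ka0 ha] b [Kb Kb0 hb]] /=.
- by exists (cmod c) => //; apply: cmod_ge0.
- exists `|B| => // z /(_ p) h; rewrite (le_trans h) // ler_norm //.
- exists `|B| => // z /(_ p) h; rewrite cmodJ (le_trans h) // ler_norm //.
- exists (Ka + Kb) => [|z hz]; first by rewrite addr_ge0.
  by rewrite (le_trans (cmodD _ _)) // lerD ?ha ?hb.
- exists (Ka * Kb) => [|z hz]; first by rewrite mulr_ge0.
  by rewrite cmodM ler_pM ?cmod_ge0 ?ha ?hb.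
Qed.

Lemma dirD_bounded e B :
  exists2 K, 0 <= K &
    forall z d, cbounded B z -> cbounded B d -> cmod (dirD d e z) <= K.
Proof.
elim: e => [c|p|p|a [Ka Ka0 ha] b [Kb Kb0 hb]|a [Ka Ka0 ha] b [Kb Kb0 hb]] /=.
- by exists 0 => // z d _ _; rewrite dirD_Cst cmod0.
- by exists `|B| => // z d _ /(_ p) h; rewrite dirD_Zvar (le_trans h) // ler_norm.
- by exists `|B| => // z d _ /(_ p) h; rewrite dirD_Wvar cmodJ (le_trans h) // ler_norm.
- exists (Ka + Kb) => [|z d hz hd]; first by rewrite addr_ge0.
  by rewrite dirD_Add (le_trans (cmodD _ _)) // lerD ?ha ?hb.
- have [Ea Ea0 hea] := peval_bounded a B; have [Eb Eb0 heb] := peval_bounded b B.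
  exists (Ka * Eb + Ea * Kb) => [|z d hz hd]; first by rewrite addr_ge0 ?mulr_ge0.
  rewrite dirD_Mul (le_trans (cmodD _ _)) // !cmodM.
  by rewrite lerD // ler_pM ?cmod_ge0 ?ha ?hb ?hea ?heb.
Qed.

(** The endpoint [z'] may miss [z + s d] by a term of order [s ^+ 2], so the estimate applies along
    curves tangent to [d], such as orbits of rotations. By induction on the syntax of [e]; only
    products need an argument. *)
Lemma taylor1 e B : exists2 K, 0 <= K & forall (s : R) z z' d,
  0 < s <= 1 -> cbounded B z -> cbounded B z' -> cbounded B d ->
  (forall p, cmod (z' p 0 - z p 0 - (s%:C)%C * d p 0) <= B * s ^+ 2) ->
  cmod (peval e z' - peval e z - (s%:C)%C * dirD d e z) <= K * s ^+ 2.
Proof.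
elim: e => [c|p|p|a [Ka Ka0 ha] b [Kb Kb0 hb]|a [Ka Ka0 ha] b [Kb Kb0 hb]] /=.
- by exists 0 => // s z z' d *; rewrite dirD_Cst mulr0 subrr subr0 cmod0 mul0r.
- exists `|B| => // s z z' d _ _ _ _ /(_ p) h; rewrite dirD_Zvar (le_trans h) //.
  by rewrite ler_wpM2r ?sqr_ge0 ?ler_norm.
- exists `|B| => // s z z' d _ _ _ _ /(_ p) h; rewrite dirD_Wvar.
  rewrite -[X in X * conjc _]conjc_real -!(rmorphM, rmorphB) /= cmodJ.
  by rewrite (le_trans h) // ler_wpM2r ?sqr_ge0 ?ler_norm.
- exists (Ka + Kb) => [|s z z' d hs hz hz' hd h]; first by rewrite addr_ge0.
  rewrite dirD_Add mulrDl.
  have -> : peval a z' + peval b z' - (peval a z + peval b z)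
      - (s%:C)%C * (dirD d a z + dirD d b z) =
    (peval a z' - peval a z - (s%:C)%C * dirD d a z) +
    (peval b z' - peval b z - (s%:C)%C * dirD d b z) by ring.
  by rewrite (le_trans (cmodD _ _)) // lerD ?ha ?hb.
- have [Ea Ea0 hea] := peval_bounded a B; have [Eb Eb0 heb] := peval_bounded b B.
  have [Da Da0 hda] := dirD_bounded a B; have [Db Db0 hdb] := dirD_bounded b B.
  exists (Ka * Eb + Ea * Kb + Da * (Kb + Db)) => [|s z z' d hs hz hz' hd h].
    by rewrite !addr_ge0 ?mulr_ge0 ?addr_ge0.
  rewrite dirD_Mul.
  (* Besides the remainders of the two factors there is a cross term, the first-order part of [a]
     times the increment of [b]; it is quadratic in [s] because that increment is of order [s]. *)
  have -> : peval a z' * peval b z' - peval a z * peval b z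
      - (s%:C)%C * (dirD d a z * peval b z + peval a z * dirD d b z) =
    (peval a z' - peval a z - (s%:C)%C * dirD d a z) * peval b z' +
    peval a z * (peval b z' - peval b z - (s%:C)%C * dirD d b z) +
    (s%:C)%C * dirD d a z * ((peval b z' - peval b z - (s%:C)%C * dirD d b z)
       + (s%:C)%C * dirD d b z) by ring.
  have [s0 s1] := andP hs.
  rewrite [leRHS]mulrDl [(_ + _) * s ^+ 2]mulrDl; apply: (le_trans (cmodD _ _)); apply: lerD.
    apply: (le_trans (cmodD _ _)); apply: lerD; rewrite cmodM.
      by rewrite mulrAC ler_pM ?cmod_ge0 ?ha ?heb.
    by rewrite -mulrA ler_pM ?cmod_ge0 ?hb ?hea.
  rewrite !cmodM cmod_real gtr0_norm //.
  have -> : Da * (Kb + Db) * s ^+ 2 = (s * Da) * (s * Kb + s * Db) by ring.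
  rewrite ler_pM ?mulr_ge0 ?cmod_ge0 ?(ltW s0) //.
    by rewrite ler_wpM2l ?(ltW s0) // hda.
  apply: (le_trans (cmodD _ _)); apply: lerD; last first.
    by rewrite cmodM cmod_real gtr0_norm // ler_wpM2l ?(ltW s0) // hdb.
  apply: (le_trans (hb _ _ _ _ _ _ _ _ _)) => //.
  by rewrite expr2 [leRHS]mulrC ler_wpM2l // ler_piMr // ltW.
Qed.

Lemma cbounded_exists z : exists2 B, 0 <= B & cbounded B z.
Proof.
exists (\sum_p cmod (z p 0)) => [|p]; first by rewrite sumr_ge0 // => p _; apply: cmod_ge0.
by rewrite (bigD1 p) //= lerDl sumr_ge0 // => q _; apply: cmod_ge0.
Qed.

(** Subtracting the Taylor estimates of [a] and [b] on the segment from [z] along [d] leaves only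
    terms in [s ^+ 2]. Hence syntactic derivatives depend on the function alone, and identities
    between values may be differentiated. *)
Lemma peval_eq_dirD a b d z : peval a =1 peval b -> dirD d a z = dirD d b z.
Proof.
move=> ab; apply/eqP; rewrite -subr_eq0; apply/eqP.
have [Bz Bz0 hBz] := cbounded_exists z; have [Bd Bd0 hBd] := cbounded_exists d.
have [Ka Ka0 ha] := taylor1 a (Bz + Bd); have [Kb Kb0 hb] := taylor1 b (Bz + Bd).
apply: (@small_quadratic_eq0 _ _ (Ka + Kb)) => s hs.
have [s0 s1] := andP hs.
pose z' := z + (s%:C)%C *: d.
have hz' : cbounded (Bz + Bd) z'.
  move=> p; rewrite !mxE (le_trans (cmodD _ _)) // lerD ?hBz //.
  by rewrite cmodM cmod_real gtr0_norm // (le_trans _ (hBd p)) // ler_piMl ?cmod_ge0.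
have hz : cbounded (Bz + Bd) z by move=> p; rewrite (le_trans (hBz p)) // lerDl.
have hd : cbounded (Bz + Bd) d by move=> p; rewrite (le_trans (hBd p)) // lerDr.
have hh p : cmod (z' p 0 - z p 0 - (s%:C)%C * d p 0) <= (Bz + Bd) * s ^+ 2.
  have -> : z' p 0 - z p 0 - (s%:C)%C * d p 0 = 0 by rewrite !mxE; ring.
  by rewrite cmod0 mulr_ge0 ?sqr_ge0 ?addr_ge0.
have := ha _ _ _ _ hs hz hz' hd hh; have := hb _ _ _ _ hs hz hz' hd hh.
rewrite -!ab => {}hb {}ha.
have -> : (s%:C)%C * (dirD d a z - dirD d b z) =
  (peval a z' - peval a z - (s%:C)%C * dirD d b z) +
  - (peval a z' - peval a z - (s%:C)%C * dirD d a z) by ring.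
by rewrite (le_trans (cmodD _ _)) // cmodN mulrDl addrC lerD.
Qed.

Lemma dirD_delta c p e z :
  dirD (c *: delta_mx p 0) e z = c * peval (dz p e) z + conjc c * peval (dw p e) z.
Proof.
rewrite /dirD (bigD1 p) //= !mxE !eqxx mulr1 big1 ?addr0 // => q qp.
by rewrite !mxE (negPf qp) /= mulr0 conjc0 !mul0r addr0.
Qed.

(* The directions [e_p] and [i e_p] separate the two Wirtinger derivatives. *)
Lemma peval_eq_dzdw a b p z : peval a =1 peval b ->
  peval (dz p a) z = peval (dz p b) z /\ peval (dw p a) z = peval (dw p b) z.
Proof.
move=> ab.
have := peval_eq_dirD (1 *: delta_mx p 0) z ab.
have := peval_eq_dirD ('i%C *: delta_mx p 0) z ab.
rewrite !dirD_delta conjc1 !mul1r.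
have -> : conjc 'i%C = - 'i%C :> C by apply/eqP; rewrite eq_complex /= oppr0 !eqxx.
set A := peval _ _; set B := peval _ _; set A' := peval _ _; set B' := peval _ _.
rewrite !mulNr -!mulrBr.
have i0 : ('i%C : C) != 0 by rewrite eq_complex /= oner_eq0 andbF.
move=> /(mulfI i0) h1 h2.
have two0 : (2 : C) != 0 by rewrite pnatr_eq0.
split; apply: (mulfI two0).
  by transitivity ((A - B) + (A + B)); [ring | rewrite h1 h2; ring].
by transitivity ((A + B) - (A - B)); [ring | rewrite h1 h2; ring].
Qed.

Lemma peval_eq_dz a b p : peval a =1 peval b -> peval (dz p a) =1 peval (dz p b).
Proof. by move=> ab z; have [] := peval_eq_dzdw p z ab. Qed.

Lemma peval_eq_dw a b p : peval a =1 peval b -> peval (dw p a) =1 peval (dw p b).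
Proof. by move=> ab z; have [] := peval_eq_dzdw p z ab. Qed.

(** Cut the segment from 0 to [z] into [n.+1] equal pieces: with zero derivatives each piece changes
    the value by at most [K / n.+1 ^ 2], so the total change is at most [K / n.+1] for every [n]. *)
Lemma peval_const e :
  (forall p z, peval (dz p e) z = 0) -> (forall p z, peval (dw p e) z = 0) ->
  forall z, peval e z = peval e 0.
Proof.
move=> hz hw z; apply/eqP; rewrite -subr_eq0; apply/eqP.
have [B B0 hB] := cbounded_exists z; have [K K0 hK] := taylor1 e B.
have D0 d y : dirD d e y = 0.
  by rewrite /dirD big1 // => p _; rewrite hz hw !mulr0 addr0.
have step (n i : nat) : (i <= n.+1)%N ->
  cmod (peval e ((i%:R / n.+1%:R)%:C%C *: z) - peval e 0) <= i%:R * (K * (n.+1%:R^-1) ^+ 2).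
  elim: i => [|i IHi] hi; first by rewrite mul0r scale0r subrr cmod0 mul0r.
  have cb (j : nat) : (j <= n.+1)%N -> cbounded B ((j%:R / n.+1%:R)%:C%C *: z).
    move=> hj p; rewrite mxE cmodM cmod_real (le_trans _ (hB p)) //.
    rewrite ler_piMl ?cmod_ge0 // ger0_norm ?divr_ge0 //.
    by rewrite ler_pdivrMr ?mul1r ?ler_nat // ltr0n.
  have hs : 0 < (n.+1%:R^-1 : R) <= 1.
    by rewrite invr_gt0 ltr0n /= invf_le1 ?ltr0n // ler1n.
  have hd p : cmod (((i.+1%:R / n.+1%:R)%:C%C *: z) p 0 - ((i%:R / n.+1%:R)%:C%C *: z) p 0
      - (n.+1%:R^-1)%:C%C * z p 0) <= B * n.+1%:R^-1 ^+ 2.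
    rewrite !mxE -natr1 mulrDl mul1r rmorphD /=.
    have -> (a b c : C) : (a + b) * c - a * c - b * c = 0 by ring.
    by rewrite cmod0 mulr_ge0 ?sqr_ge0.
  have := hK _ _ _ _ hs (cb i (ltnW hi)) (cb _ hi) hB hd; rewrite D0 mulr0 subr0.
  move=> /(lerD (IHi (ltnW hi))) h.
  rewrite [leRHS]mulrC [X in _ <= _ * X]mulrSr [leRHS]mulrDr mulr1 [_ * i%:R]mulrC.
  apply: le_trans h; apply: le_trans (cmodD _ _); rewrite le_eqVlt; apply/orP; left.
  by apply/eqP; congr cmod; rewrite [RHS]addrC addrA subrK.
apply: cmod0_eq0; apply/eqP; rewrite eq_le cmod_ge0 andbT leNgt; apply/negP => c0.
have [n hn] : exists n : nat, K / cmod (peval e z - peval e 0) < n.+1%:R.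
  have /archi_boundP h : 0 <= K / cmod (peval e z - peval e 0) by rewrite divr_ge0 // ltW.
  by exists (Num.bound (K / cmod (peval e z - peval e 0))); rewrite (lt_le_trans h) // ler_nat.
have := step n n.+1 (leqnn _); rewrite divff ?pnatr_eq0 // scale1r.
have -> : n.+1%:R * (K * n.+1%:R^-1 ^+ 2) = K / n.+1%:R.
  by field; rewrite lt0r_neq0 // -[_ + 1]/(n%:R + 1) natr1 ltr0n.
rewrite leNgt ltr_pdivrMr ?ltr0n // => /negP; apply.
by move: hn; rewrite ltr_pdivrMr // mulrC.
Qed.

End Polynomials.

(** * Sums of complex numbers: weighted AM-GM and Bessel's identity *)

Section ComplexSums.
Variable R : realType.
Local Notation C := R[i].

Lemma eq_big_all (T : Type) (a : pred T) (s : seq T) (F G : T -> C) :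
  all a s -> (forall i, a i -> F i = G i) ->
  \sum_(i <- s) F i = \sum_(i <- s) G i.
Proof.
move=> + FG; elim: s => [|i s IHs] /=; first by rewrite !big_nil.
by case/andP=> ai /IHs; rewrite !big_cons FG // => ->.
Qed.

Lemma real_complex_sum (T : Type) (s : seq T) (F : T -> R) :
  ((\sum_(i <- s) F i)%:C)%C = \sum_(i <- s) ((F i)%:C)%C.
Proof. exact: (raddf_sum (real_complex R)). Qed.

Lemma conjc_sum (T : Type) (s : seq T) (F : T -> C) :
  conjc (\sum_(i <- s) F i) = \sum_(i <- s) conjc (F i).
Proof. exact: (raddf_sum (@conjc R)). Qed.

Lemma conjc_natM (j : nat) (x : C) : conjc (j%:R * x) = j%:R * conjc x.
Proof. by rewrite rmorphM /= conjc_nat. Qed.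

(* Weighted AM-GM; optimising the weight [t] replaces Cauchy-Schwarz. *)
Lemma cmod_sum_amgm (T : Type) (s : seq T) (x y : T -> C) (t : R) : 0 < t ->
  2 * cmod (\sum_(i <- s) x i * y i) <=
  t * \sum_(i <- s) cmod (x i) ^+ 2 + t^-1 * \sum_(i <- s) cmod (y i) ^+ 2.
Proof.
move=> t0; rewrite !mulr_sumr -big_split /=.
apply: (@le_trans _ _ (\sum_(i <- s) 2 * cmod (x i * y i))).
  by rewrite -mulr_sumr ler_pM2l // cmod_sum.
apply: ler_sum => i _; rewrite cmodM.
set a := cmod _; set b := cmod _; rewrite -subr_ge0.
have -> : t * a ^+ 2 + t^-1 * b ^+ 2 - 2 * (a * b) = t * (a - t^-1 * b) ^+ 2.
  by field; rewrite gt_eqF.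
by rewrite mulr_ge0 ?sqr_ge0 // ltW.
Qed.

(** Pythagoras for the projection onto the unit vector [b]. Used with [b = z] on the sphere, where
    it separates the radial part of a gradient. *)
Lemma bessel (T : Type) (r : seq T) (a b : T -> C) :
  \sum_(i <- r) b i * conjc (b i) = 1 ->
  \sum_(i <- r) cmod (a i - (\sum_(l <- r) a l * conjc (b l)) * b i) ^+ 2 =
  \sum_(i <- r) cmod (a i) ^+ 2 - cmod (\sum_(i <- r) a i * conjc (b i)) ^+ 2.
Proof.
set s := \sum_(l <- r) a l * conjc (b l) => hb; apply: complexI.
rewrite rmorphB /= !real_complex_sum !cmod_sqr.
under eq_bigr do rewrite cmod_sqr.
under [X in _ = X - _]eq_bigr do rewrite cmod_sqr.
transitivity (\sum_(i <- r) (a i * conjc (a i) - conjc s * (a i * conjc (b i))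
   - s * conjc (a i * conjc (b i)) + s * conjc s * (b i * conjc (b i)))).
  by apply: eq_bigr => i _; rewrite !(rmorphB, rmorphM) /= conjcK; ring.
rewrite big_split /= !sumrB -!mulr_sumr -conjc_sum hb -/s; ring.
Qed.

End ComplexSums.

(** * Hermitian forms in homogeneous holomorphic polynomials and their Laplacians *)

Section Blocks.
Variables (R : realType) (N n : nat).
Local Notation C := R[i].
Implicit Types (z : 'cV[C]_N) (M : 'M[C]_n).

Local Notation block := ('I_n -> cpoly R N).
Implicit Types (Phi : block) (L : seq block).

Definition sqnorm z : C := \sum_p z p 0 * conjc (z p 0).

Definition Sqnorm : cpoly R N :=
  Sum (index_enum 'I_N) (fun p => Mul (Zvar _ p) (Wvar _ p)).

Lemma peval_Sqnorm z : peval Sqnorm z = sqnorm z.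
Proof. by rewrite peval_Sum. Qed.

Lemma peval_dz_Sqnorm p z : peval (dz p Sqnorm) z = conjc (z p 0).
Proof.
rewrite dz_Sum peval_Sum (bigD1 p) //= eqxx mul1r mulr0 addr0 big1 ?addr0 // => q.
by rewrite eq_sym => /negPf ->; rewrite mul0r mulr0 addr0.
Qed.

Lemma peval_dw_Sqnorm p z : peval (dw p Sqnorm) z = z p 0.
Proof.
rewrite dw_Sum peval_Sum (bigD1 p) //= eqxx mulr1 mul0r add0r big1 ?addr0 // => q.
by rewrite eq_sym => /negPf ->; rewrite mul0r mulr0 addr0.
Qed.

(** The complex Hessian of [|z|^(2j)]. The truncated exponents [j.-1] and [j.-2] are harmless for
    small [j], since the factors [j] and [j.-1] in front then vanish. *)
Lemma peval_dzdw_Sqnorm_pow p q j z :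
  peval (dz q (dw p (Pow Sqnorm j))) z =
  j%:R * (j.-1%:R * sqnorm z ^+ j.-2 * conjc (z q 0) * z p 0
          + (q == p)%:R * sqnorm z ^+ j.-1).
Proof.
have h : peval (dw p (Pow Sqnorm j)) =1
    peval (Mul (Mul (Cst _ j%:R) (Pow Sqnorm j.-1)) (Zvar _ p)).
  by move=> y; rewrite peval_dw_Pow peval_dw_Sqnorm /= peval_Pow.
rewrite (peval_eq_dz q h) /= peval_dz_Pow peval_dz_Sqnorm peval_Pow peval_Sqnorm.
ring.
Qed.

(** The sum of [<Phi | M | Phi>] over a list of vector-valued polynomials. Lists are allowed so that
    the Laplacian of such a form is again such a form, over [diff_blocks L]. *)
Definition herm_form M L : cpoly R N :=
  Sum L (fun Phi => Sum (index_enum 'I_n) (fun x => Sum (index_enum 'I_n)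
    (fun y => Mul (Cst _ (M x y)) (Mul (cj (Phi x)) (Phi y))))).

Definition diff_blocks L : seq block :=
  [seq (fun x => dz p (Phi x)) | Phi <- L, p <- index_enum 'I_N].

(** Homogeneity of degree [j] is encoded by Euler's identity, the form in which it is used and in
    which it passes to derivatives. *)
Definition homog_block (j : nat) Phi : Prop :=
  (forall x, holo (Phi x)) /\
  forall x z, \sum_p z p 0 * peval (dz p (Phi x)) z = j%:R * peval (Phi x) z.

Definition homog_blocks j L : bool := all (fun Phi => `[< homog_block j Phi >]) L.

Lemma peval_herm_form M L z : peval (herm_form M L) z =
  \sum_(Phi <- L) \sum_x \sum_y M x y * (conjc (peval (Phi x) z) * peval (Phi y) z).
Proof.
rewrite peval_Sum; apply: eq_bigr => Phi _; rewrite peval_Sum.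
apply: eq_bigr => x _; rewrite peval_Sum; apply: eq_bigr => y _ /=.
by rewrite peval_cj.
Qed.

Lemma peval_dw_herm_form j M L p z : homog_blocks j L ->
  peval (dw p (herm_form M L)) z = \sum_(Phi <- L) \sum_x \sum_y
    M x y * (conjc (peval (dz p (Phi x)) z) * peval (Phi y) z).
Proof.
move=> hL; rewrite dw_Sum peval_Sum; apply: (eq_big_all hL) => Phi /asboolP[hol _].
rewrite dw_Sum peval_Sum; apply: eq_bigr => x _.
rewrite dw_Sum peval_Sum; apply: eq_bigr => y _ /=.
by rewrite dw_cj !peval_cj (holo_dw p z (hol y)); ring.
Qed.

Lemma peval_dz_herm_form j M L p z : homog_blocks j L ->
  peval (dz p (herm_form M L)) z = \sum_(Phi <- L) \sum_x \sum_y
    M x y * (conjc (peval (Phi x) z) * peval (dz p (Phi y)) z).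
Proof.
move=> hL; rewrite dz_Sum peval_Sum; apply: (eq_big_all hL) => Phi /asboolP[hol _].
rewrite dz_Sum peval_Sum; apply: eq_bigr => x _.
rewrite dz_Sum peval_Sum; apply: eq_bigr => y _ /=.
by rewrite dz_cj !peval_cj (holo_dw p z (hol x)) conjc0; ring.
Qed.

Lemma peval_dzdw_herm_form j M L p q z : homog_blocks j L ->
  peval (dz q (dw p (herm_form M L))) z = \sum_(Phi <- L) \sum_x \sum_y
    M x y * (conjc (peval (dz p (Phi x)) z) * peval (dz q (Phi y)) z).
Proof.
move=> hL; rewrite dw_Sum dz_Sum peval_Sum.
apply: (eq_big_all hL) => Phi /asboolP[hol _].
rewrite dw_Sum dz_Sum peval_Sum; apply: eq_bigr => x _.
rewrite dw_Sum dz_Sum peval_Sum; apply: eq_bigr => y _ /=.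
rewrite dw_cj !dz_cj !peval_cj (holo_dw p z (hol y)) (holo_dzdw p q z (hol y)).
by rewrite (holo_dw q z (holo_dz p (hol x))) conjc0; ring.
Qed.

(** For holomorphic blocks the conjugate derivative hits only the bra and the holomorphic one only
    the ket, so the mixed derivative differentiates both by the same variable. *)
Lemma laplacian_herm_form j M L z : homog_blocks j L ->
  \sum_p peval (dz p (dw p (herm_form M L))) z = peval (herm_form M (diff_blocks L)) z.
Proof.
move=> hL; rewrite peval_herm_form big_allpairs_dep exchange_big /=.
apply: eq_bigr => p _; exact: peval_dzdw_herm_form hL.
Qed.

(** Differentiating Euler's identity in [z_p] produces one extra copy of the derivative, which
    lowers the degree by one. *)
Lemma homog_diff_blocks j L : homog_blocks j.+1 L -> homog_blocks j (diff_blocks L).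
Proof.
rewrite /homog_blocks /diff_blocks; elim: L => //= Phi L IHL /andP[/asboolP[hol eul] hL].
rewrite all_cat IHL // andbT all_map; apply/allP => p _ /=; apply/asboolP.
split=> [x|x z]; first exact: holo_dz.
have h : peval (Sum (index_enum 'I_N) (fun q => Mul (Zvar _ q) (dz q (Phi x)))) =1
    peval (Mul (Cst _ j.+1%:R) (Phi x)).
  by move=> y; rewrite peval_Sum /= -eul.
have := peval_eq_dz p h z; rewrite dz_Sum peval_Sum /= mul0r add0r big_split /=.
rewrite (bigD1 p) //= eqxx mul1r big1 ?addr0; last first.
  by move=> q; rewrite eq_sym => /negPf ->; rewrite mul0r.
rewrite -natr1 mulrDl mul1r addrC => /addIr <-.
by apply: eq_bigr => q _; rewrite dzC.
Qed.

Lemma euler_herm_form j M L z : homog_blocks j L ->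
  \sum_p conjc (z p 0) * peval (dw p (herm_form M L)) z =
  j%:R * peval (herm_form M L) z.
Proof.
move=> hL; rewrite peval_herm_form mulr_sumr.
under eq_bigr do rewrite (peval_dw_herm_form _ _ _ hL) mulr_sumr.
rewrite exchange_big /=; apply: (eq_big_all hL) => Phi /asboolP[_ eul].
under eq_bigr do rewrite mulr_sumr.
rewrite exchange_big mulr_sumr; apply: eq_bigr => x _ /=.
under eq_bigr do rewrite mulr_sumr.
rewrite exchange_big mulr_sumr; apply: eq_bigr => y _ /=.
transitivity (M x y * peval (Phi y) z *
    conjc (\sum_p z p 0 * peval (dz p (Phi x)) z)).
  by rewrite conjc_sum mulr_sumr; apply: eq_bigr => p _; rewrite rmorphM /=; ring.
by rewrite eul rmorphM /= conjc_nat; ring.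
Qed.

Lemma herm_form_real M L z : Defs.hermitian M ->
  conjc (peval (herm_form M L) z) = peval (herm_form M L) z.
Proof.
move=> hM; rewrite peval_herm_form conjc_sum; apply: eq_bigr => Phi _.
rewrite conjc_sum exchange_big /=; apply: eq_bigr => x _.
rewrite conjc_sum; apply: eq_bigr => y _.
by rewrite -{2}hM mxE !rmorphM /= conjcK; ring.
Qed.

Lemma herm_form_dzE j M L p z : homog_blocks j L -> Defs.hermitian M ->
  peval (dz p (herm_form M L)) z = conjc (peval (dw p (herm_form M L)) z).
Proof.
move=> hL hM; rewrite (peval_dw_herm_form _ _ _ hL) (peval_dz_herm_form _ _ _ hL).
rewrite conjc_sum; apply: eq_bigr => Phi _.
rewrite conjc_sum exchange_big /=; apply: eq_bigr => x _.
rewrite conjc_sum; apply: eq_bigr => y _.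
by rewrite -{1}hM mxE !rmorphM /= conjcK; ring.
Qed.

Lemma herm_form1 L z : peval (herm_form 1%:M L) z =
  ((\sum_(Phi <- L) \sum_x cmod (peval (Phi x) z) ^+ 2)%:C)%C.
Proof.
rewrite peval_herm_form real_complex_sum; apply: eq_bigr => Phi _.
rewrite real_complex_sum; apply: eq_bigr => x _.
rewrite (bigD1 x) //= mxE eqxx big1 ?addr0; last first.
  by move=> y; rewrite eq_sym mxE => /negPf ->; rewrite mul0r.
by rewrite cmod_sqr mul1r mulrC.
Qed.

(** Identifies the Hessian of [sum |Phi|^2], as a quadratic form in [a], with the squared norm of
    the derivatives of the blocks along [a]. It makes these derivatives computable once
    [sum |Phi|^2] is known. *)
Lemma dzdw_herm_form1 j L z (a : 'I_N -> C) : homog_blocks j L ->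
  \sum_p \sum_q conjc (a p) * a q * peval (dz q (dw p (herm_form 1%:M L))) z =
  ((\sum_(Phi <- L) \sum_x
     cmod (\sum_p a p * peval (dz p (Phi x)) z) ^+ 2)%:C)%C.
Proof.
move=> hL.
under eq_bigr do under eq_bigr do rewrite (peval_dzdw_herm_form _ _ _ _ hL) mulr_sumr.
under eq_bigr do rewrite exchange_big /=.
rewrite exchange_big /= real_complex_sum; apply: eq_bigr => Phi _.
under eq_bigr do under eq_bigr do rewrite mulr_sumr.
under eq_bigr do rewrite exchange_big /=.
rewrite exchange_big /= real_complex_sum; apply: eq_bigr => x _.
rewrite cmod_sqr conjc_sum mulrC mulr_suml; apply: eq_bigr => p _.
rewrite mulr_sumr; apply: eq_bigr => q _.
rewrite (bigD1 x) //= mxE eqxx big1 ?addr0; last first.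
  by move=> y; rewrite eq_sym mxE => /negPf ->; rewrite mul0r.
by rewrite mul1r rmorphM /=; ring.
Qed.

(** When [a] is the gradient itself, its squared norm equals the pairing of the derivative of [Phi]
    along [a] with [M Phi], summed over the blocks. AM-GM splits the pairing, and the operator norm
    bound removes [M]. *)
Lemma grad_amgm j M L z (t : R) (a : 'I_N -> C) :
  homog_blocks j L -> opnorm_le1 M -> 0 < t ->
  (forall p, a p = peval (dw p (herm_form M L)) z) ->
  2 * \sum_p cmod (a p) ^+ 2 <=
  t * \sum_(Phi <- L) \sum_x cmod (\sum_p a p * peval (dz p (Phi x)) z) ^+ 2
  + t^-1 * \sum_(Phi <- L) \sum_x cmod (peval (Phi x) z) ^+ 2.
Proof.
move=> hL hM t0 ha.
pose v Phi : 'cV[C]_n := \col_x peval (Phi x) z.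
have aE : ((\sum_p cmod (a p) ^+ 2)%:C)%C = \sum_(Phi <- L) \sum_x
    conjc (\sum_p a p * peval (dz p (Phi x)) z) * (M *m v Phi) x 0.
  rewrite real_complex_sum.
  transitivity (\sum_p conjc (a p) * a p).
    by apply: eq_bigr => p _; rewrite cmod_sqr mulrC.
  under eq_bigr do rewrite [X in _ * X]ha (peval_dw_herm_form _ _ _ hL) mulr_sumr.
  rewrite exchange_big /=; apply: eq_bigr => Phi _.
  under eq_bigr do rewrite mulr_sumr.
  rewrite exchange_big /=; apply: eq_bigr => x _.
  rewrite conjc_sum mulr_suml; apply: eq_bigr => p _.
  rewrite mxE !mulr_sumr; apply: eq_bigr => y _.
  by rewrite mxE rmorphM /=; ring.
have A0 : 0 <= \sum_p cmod (a p) ^+ 2 by rewrite sumr_ge0 // => p _; rewrite sqr_ge0.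
rewrite -[\sum_p _](ger0_norm A0) -cmod_real aE !mulr_sumr -big_split /=.
apply: (@le_trans _ _ (\sum_(Phi <- L) 2 * cmod (\sum_x
    conjc (\sum_p a p * peval (dz p (Phi x)) z) * (M *m v Phi) x 0))).
  by rewrite -mulr_sumr ler_pM2l // cmod_sum.
apply: ler_sum => Phi _; apply: le_trans (cmod_sum_amgm _ _ _ t0) _.
rewrite lerD //.
  by rewrite ler_pM2l // le_eqVlt; apply/orP; left; apply/eqP/eq_bigr => x _; rewrite cmodJ.
rewrite ler_pM2l ?invr_gt0 //; apply: le_trans (hM (v Phi)) _.
by rewrite le_eqVlt; apply/orP; left; apply/eqP/eq_bigr => x _; rewrite mxE.
Qed.

End Blocks.

(** * The iterated Laplacians of the form and their gradient bounds *)

Section Tower.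
Variables (R : realType) (N n k : nat).
Local Notation C := R[i].
Variables (Psi : 'I_n -> cpoly R N) (O : 'M[C]_n).
Hypotheses (N0 : (0 < N)%N).
Hypothesis homPsi : homog_block k Psi.
Hypothesis sqPsi : forall z, peval (herm_form 1%:M [:: Psi]) z = sqnorm z ^+ k.
Hypothesis admO : admissible O.

Definition level m := iter m (@diff_blocks R N n) [:: Psi].
Definition level_form m := herm_form O (level m).
Definition level_cst m : nat := \prod_(i < m) ((k - i) * (N + (k - i)).-1).

Lemma level_cst_gt0 m : (m <= k)%N -> (0 < level_cst m)%N.
Proof.
move=> mk; rewrite prodn_gt0 // => i; rewrite muln_gt0.
by have := ltn_ord i; lia.
Qed.

Lemma homog_level m : (m <= k)%N -> homog_blocks (k - m) (level m).
Proof.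
elim: m => [|m IHm] mk; first by rewrite /homog_blocks /= subn0 andbT; apply/asboolP.
by apply: homog_diff_blocks; rewrite subnSK // IHm // ltnW.
Qed.

(** With [M = 1] each new level is the Laplacian of the previous one, and the Laplacian of
    [|z|^(2j)] is [j (N + j - 1) |z|^(2(j-1))]; these factors make up [level_cst]. *)
Lemma sqnorm_level m z : (m <= k)%N ->
  peval (herm_form 1%:M (level m)) z = (level_cst m)%:R * sqnorm z ^+ (k - m).
Proof.
elim: m z => [|m IHm] z mk.
  by rewrite sqPsi subn0 /level_cst big_ord0 mul1r.
have h : peval (herm_form 1%:M (level m)) =1
    peval (Mul (Cst _ (level_cst m)%:R) (Pow (Sqnorm R N) (k - m))).
  by move=> y; rewrite IHm ?(ltnW mk) //= peval_Pow peval_Sqnorm.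
rewrite /= -(laplacian_herm_form _ _ (homog_level (ltnW mk))).
under eq_bigr => p _.
  rewrite (peval_eq_dz p (peval_eq_dw p h)) /= peval_dzdw_Sqnorm_pow eqxx.
  rewrite !mul0r !add0r mul1r.
  over.
rewrite /level_cst big_ord_recr /= -/(level_cst m) natrM -subnSK // /=.
set j := (k - m.+1)%N; rewrite -!mulr_sumr big_split /= sumr_const card_ord.
rewrite natrM -!mulrA; congr (_ * (_ * _)).
under eq_bigr => p _ do rewrite -mulrA [conjc _ * _]mulrC.
rewrite -!mulr_sumr addnS /= natrD mulrDl -mulr_natl addrC; congr (_ + _).
  by rewrite mulr_natl.
by rewrite -/(sqnorm z); case: j => [|j] /=; rewrite !mulr1 ?mul0r // -mulrA -exprSr.
Qed.

Lemma dzdw_level m p q z : (m <= k)%N ->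
  peval (dz q (dw p (herm_form 1%:M (level m)))) z =
  (level_cst m * (k - m))%:R * ((k - m).-1%:R * sqnorm z ^+ (k - m).-2
    * conjc (z q 0) * z p 0 + (q == p)%:R * sqnorm z ^+ (k - m).-1).
Proof.
move=> mk.
have h : peval (herm_form 1%:M (level m)) =1
    peval (Mul (Cst _ (level_cst m)%:R) (Pow (Sqnorm R N) (k - m))).
  by move=> y; rewrite sqnorm_level //= peval_Pow peval_Sqnorm.
rewrite (peval_eq_dz q (peval_eq_dw p h)) /= peval_dzdw_Sqnorm_pow natrM; ring.
Qed.

(** At a unit vector the Hessian of [c |z|^(2j)] is [c j] times the identity plus [j - 1] times the
    projection on [z], hence at most [c j^2]. Inserted in [grad_amgm] this gives
    [2 A <= A + (c j)^2] for the squared gradient [A]. *)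
Lemma level_grad_le m z : (m < k)%N -> sqnorm z = 1 ->
  \sum_p cmod (peval (dw p (level_form m)) z) ^+ 2 <= (level_cst m * (k - m))%:R ^+ 2.
Proof.
move=> mk z1; set c := level_cst m; set j := (k - m)%N.
have hL := homog_level (ltnW mk).
have [_ opO] := admO.
pose a p := peval (dw p (level_form m)) z.
have j0 : (0 : R) < j%:R by rewrite ltr0n subn_gt0.
have c0 : (0 : R) < c%:R by rewrite ltr0n level_cst_gt0 // ltnW.
(* The AM-GM weight is the inverse of the Hessian bound, so that the first term is at most [A]. *)
have t0 : (0 : R) < (c%:R * j%:R ^+ 2)^-1 by rewrite invr_gt0 mulr_gt0 ?exprn_gt0.
have := grad_amgm hL opO t0 (fun p => erefl (a p)).
have -> : \sum_(Phi <- level m) \sum_x cmod (peval (Phi x) z) ^+ 2 = c%:R.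
  apply: complexI; rewrite -herm_form1 sqnorm_level ?(ltnW mk) // z1 expr1n mulr1.
  by rewrite rmorph_nat.
set D := \sum_(Phi <- _) _; set A := \sum_p _.
have A0 : 0 <= A by rewrite sumr_ge0 // => p _; rewrite sqr_ge0.
have DA : D <= c%:R * j%:R ^+ 2 * A.
  have DE : D = c%:R * j%:R * (j.-1%:R * cmod (\sum_p a p * conjc (z p 0)) ^+ 2 + A).
    apply: complexI; rewrite -(dzdw_herm_form1 z a hL).
    set S := \sum_p a p * conjc (z p 0).
    transitivity (\sum_p ((c%:R * j%:R) *
        (j.-1%:R * (conjc (a p) * z p 0) * S + conjc (a p) * a p))).
      apply: eq_bigr => p _.
      under eq_bigr do rewrite (dzdw_level _ _ _ (ltnW mk)) z1 !expr1n !mulr1 natrM.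
      transitivity (\sum_q (c%:R * j%:R * j.-1%:R * (conjc (a p) * z p 0)
            * (a q * conjc (z q 0)) + c%:R * j%:R * conjc (a p) * (a q * (q == p)%:R))).
        by apply: eq_bigr => q _; rewrite -/c -/j; ring.
      rewrite big_split /= -!mulr_sumr -/S [X in _ + _ * X = _](bigD1 p) //= eqxx mulr1 big1 ?addr0.
        by ring.
      by move=> q /negPf ->; rewrite mulr0.
    rewrite -mulr_sumr !rmorphM rmorphD rmorphM /= !rmorph_nat cmod_sqr real_complex_sum.
    rewrite big_split /= -mulr_suml -mulr_sumr; congr (_ * (_ + _)).
      rewrite conjc_sum -mulrA; congr (_ * _); rewrite mulrC; congr (_ * _).
      by apply: eq_bigr => p _; rewrite rmorphM /= conjcK.
    by apply: eq_bigr => p _; rewrite cmod_sqr mulrC.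
  have s1 : cmod (\sum_p a p * conjc (z p 0)) ^+ 2 <= A.
    rewrite -subr_ge0 -(bessel a z1) sumr_ge0 // => p _; exact: sqr_ge0.
  have -> : c%:R * j%:R ^+ 2 * A = c%:R * j%:R * (j.-1%:R * A + A).
    by rewrite -[j in RHS]prednK ?subn_gt0 // -{1 2}[j]prednK ?subn_gt0 // -natr1; ring.
  by rewrite DE ler_pM2l ?mulr_gt0 // lerD2r ler_wpM2l.
rewrite natrM exprMn => h.
have : 2 * A <= A + c%:R * (c%:R * j%:R ^+ 2).
  apply: le_trans h _; rewrite invrK lerD //; last by rewrite mulrC.
  by rewrite mulrC ler_pdivrMr ?mulr_gt0 ?exprn_gt0 // mulrC.
rewrite expr2 -mulrA; lra.
Qed.

Lemma level_form_real m z : conjc (peval (level_form m) z) = peval (level_form m) z.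
Proof. by case: admO => hO _; exact: herm_form_real. Qed.

Lemma level_euler m (z : 'cV[C]_N) : (m <= k)%N ->
  \sum_p conjc (z p 0) * peval (dw p (level_form m)) z =
  (k - m)%:R * peval (level_form m) z.
Proof. by move=> mk; exact: euler_herm_form (homog_level mk). Qed.

Lemma level_laplacian m z : (m <= k)%N ->
  \sum_p peval (dz p (dw p (level_form m))) z = peval (level_form m.+1) z.
Proof. by move=> mk; exact: laplacian_herm_form (homog_level mk). Qed.

(** By Euler's identity the radial components of the two gradients are [(k - m) h_m] and [k f], so
    the difference pairs the gradient of [h_m] with the tangential part of that of [f]. The bounds
    [c (k - m)] and [k] on the norms then multiply. *)
Lemma level_gamma_le m z : (m < k)%N -> sqnorm z = 1 ->
  cmod (\sum_p peval (dw p (level_form m)) z * peval (dz p (level_form 0)) z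
    - (k - m)%:R * k%:R * peval (level_form m) z * peval (level_form 0) z) <=
  (level_cst m * (k - m) * k)%:R.
Proof.
move=> mk z1; have k0 : (0 < k)%N by rewrite (leq_ltn_trans _ mk).
have [hO _] := admO.
pose a p := peval (dw p (level_form m)) z.
pose b p := peval (dw p (level_form 0)) z.
pose S := \sum_p b p * conjc (z p 0).
have SE : S = k%:R * peval (level_form 0) z.
  rewrite -[in k%:R](subn0 k) -(euler_herm_form _ _ (homog_level (leq0n k))).
  by apply: eq_bigr => p _; rewrite mulrC.
have aE : \sum_p a p * conjc (z p 0) = (k - m)%:R * peval (level_form m) z.
  rewrite -(euler_herm_form _ _ (homog_level (ltnW mk))).
  by apply: eq_bigr => p _; rewrite mulrC.
have -> : \sum_p peval (dw p (level_form m)) z * peval (dz p (level_form 0)) z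
    - (k - m)%:R * k%:R * peval (level_form m) z * peval (level_form 0) z =
    \sum_p a p * conjc (b p - S * z p 0).
  under [RHS]eq_bigr do rewrite rmorphB rmorphM /= mulrBr.
  rewrite sumrB; congr (_ - _).
    apply: eq_bigr => p _.
    by rewrite (herm_form_dzE _ _ (homog_level (leq0n k))).
  under eq_bigr do rewrite mulrCA.
  rewrite -mulr_sumr aE SE conjc_natM level_form_real; ring.
have c0 : (0 : R) < (level_cst m * (k - m))%:R.
  by rewrite ltr0n muln_gt0 level_cst_gt0 ?(ltnW mk) // subn_gt0.
have kR0 : (0 : R) < k%:R by rewrite ltr0n.
(* The optimal AM-GM weight: the ratio of the two norm bounds. *)
have t0 : (0 : R) < k%:R / (level_cst m * (k - m))%:R by rewrite divr_gt0.
rewrite -(ler_pM2l (ltr0n R 2)); apply: le_trans (cmod_sum_amgm _ _ _ t0) _.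
under [X in _ + _ * X]eq_bigr do rewrite cmodJ.
rewrite (bessel b z1) [(_ * _ * k)%:R]natrM.
have h1 : \sum_p cmod (a p) ^+ 2 <= (level_cst m * (k - m))%:R ^+ 2 by exact: level_grad_le.
have h2 : \sum_p cmod (b p) ^+ 2 - cmod S ^+ 2 <= k%:R ^+ 2.
  rewrite (@le_trans _ _ (\sum_p cmod (b p) ^+ 2)) // ?gerBl ?sqr_ge0 //.
  by rewrite (le_trans (level_grad_le k0 z1)) // /level_cst big_ord0 mul1n subn0.
set D := (level_cst m * (k - m))%:R in c0 t0 h1 *.
apply: (@le_trans _ _ (k%:R / D * D ^+ 2 + (k%:R / D)^-1 * k%:R ^+ 2)).
  by apply: lerD; rewrite ler_pM2l ?invr_gt0.
have -> // (x y : R) : 0 < x -> 0 < y -> x / y * y ^+ 2 + (x / y)^-1 * x ^+ 2 = 2 * (y * x).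
by move=> x0 y0; field; rewrite !gt_eqF.
Qed.

(** At level [k] the sum of [|Phi|^2] is constant, so its Hessian vanishes and [grad_amgm] forces
    the gradient of the form to vanish as well. *)
Lemma level_form_const z : peval (level_form k) z = peval (level_form k) 0.
Proof.
have [hO opO] := admO.
have hL := homog_level (leqnn k).
have dw0 p y : peval (dw p (level_form k)) y = 0.
  pose a q := peval (dw q (level_form k)) y.
  suff A0 : \sum_q cmod (a q) ^+ 2 <= 0.
    have : \sum_q cmod (a q) ^+ 2 == 0.
      by rewrite eq_le A0 sumr_ge0 // => q _; rewrite sqr_ge0.
    rewrite psumr_eq0 => [/allP/(_ p)|q _]; last by rewrite sqr_ge0.
    by rewrite mem_index_enum sqrf_eq0 => /(_ isT)/eqP/cmod0_eq0.
  have D0 : \sum_(Phi <- level k) \sum_x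
      cmod (\sum_q a q * peval (dz q (Phi x)) y) ^+ 2 = 0.
    apply: complexI; rewrite -(dzdw_herm_form1 y a hL).
    rewrite big1 // => q _; rewrite big1 // => r _.
    by rewrite (dzdw_level _ _ _ (leqnn k)) subnn muln0 mul0r mulr0.
  rewrite leNgt; apply/negP; set A := \sum_q _ => A0.
  set c : R := (level_cst k)%:R.
  have c0 : 0 < c by rewrite ltr0n level_cst_gt0.
  (* With this weight the surviving term is exactly [A], and [2 * A <= A] contradicts [0 < A]. *)
  have t0 : 0 < c / A by rewrite divr_gt0.
  have := grad_amgm hL opO t0 (fun q => erefl (a q)).
  have -> : \sum_(Phi <- level k) \sum_x cmod (peval (Phi x) y) ^+ 2 = c.
    by apply: complexI; rewrite -herm_form1 sqnorm_level // subnn expr0 mulr1 rmorph_nat.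
  rewrite D0 mulr0 add0r -/A invf_div divfK ?gt_eqF // ; lra.
apply: peval_const => p y //.
by rewrite (herm_form_dzE _ _ hL hO) -/(level_form k) dw0 conjc0.
Qed.

End Tower.

(** * Rotation-invariant states on the sphere and integration by parts *)

Section SphereState.
Variables (R : realType) (N : nat).
Local Notation C := R[i].
Implicit Types (e a b : cpoly R N).

(* The vector field [z_q d/dz_p - conj z_p d/d(conj z_q)], by which the matrix unit
   [E_pq] of the complexified Lie algebra of U(N) acts. *)
Definition rot_field (p q : 'I_N) e : cpoly R N :=
  Add (Mul (Zvar _ q) (dz p e)) (Mul (Cst _ (-1)) (Mul (Wvar _ p) (dw q e))).

(** Abstracts the average of the real part over the unit sphere. Monotonicity is tested on the
    sphere only, so [|z|^2] may be replaced by 1 under [E]; invariance is kept in infinitesimal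
    form. *)
Record sphere_state (E : cpoly R N -> R) : Prop := SphereState {
  stateD : forall a b, E (Add a b) = E a + E b;
  stateZ : forall (r : R) a, E (Mul (Cst _ (r%:C)%C) a) = r * E a;
  state_mono : forall a b,
    (forall z, sqnorm z = 1 -> complex.Re (peval a z) <= complex.Re (peval b z)) ->
    E a <= E b;
  state1 : E (Cst _ 1) = 1;
  state_rot : forall p q a, E (rot_field p q a) = 0 }.

Variable E : cpoly R N -> R.
Hypothesis stE : sphere_state E.

Lemma state_eq a b : (forall z, sqnorm z = 1 -> peval a z = peval b z) -> E a = E b.
Proof.
by move=> ab; apply/eqP; rewrite eq_le !(state_mono stE) // => z /ab ->.
Qed.

Lemma state_Sum (I : Type) (s : seq I) F : E (Sum s F) = \sum_(i <- s) E (F i).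
Proof.
elim: s => [|i s IHs] /=; last by rewrite big_cons (stateD stE) IHs.
rewrite big_nil -(mul0r (E (Cst N 0))) -(stateZ stE).
by apply: state_eq => z _ /=; rewrite mulr0.
Qed.

(** Sum [state_rot] over [p] and [q] for the functions [conj z_q G_p]. On the sphere the first part
    of the field gives the divergence because [sum |z_q|^2 = 1]; differentiating [conj z_q] in the
    second part gives the factor [N]. *)
Lemma sphere_ibp (G : 'I_N -> cpoly R N) :
  E (Sum (index_enum 'I_N) (fun p => dz p (G p))) =
  E (Sum (index_enum 'I_N) (fun p => Add (Mul (Cst N N%:R) (Mul (Wvar _ p) (G p)))
    (Sum (index_enum 'I_N) (fun q => Mul (Wvar _ p) (Mul (Wvar _ q) (dw q (G p))))))).
Proof.
set A := E _; set Q := Sum _ _.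
have -> : A = E (Add (Sum (index_enum 'I_N) (fun p => Sum (index_enum 'I_N)
    (fun q => rot_field p q (Mul (Wvar _ q) (G p))))) Q).
  apply: state_eq => z z1 /=; rewrite !peval_Sum -big_split /=.
  apply: eq_bigr => p _; rewrite !peval_Sum /=.
  rewrite [_ + \sum_q _]addrC addrA -big_split /=.
  transitivity (\sum_q (z q 0 * conjc (z q 0) * peval (dz p (G p)) z
      - conjc (z p 0) * peval (G p) z) + N%:R * (conjc (z p 0) * peval (G p) z)).
    rewrite sumrB -mulr_suml -/(sqnorm z) z1 mul1r sumr_const card_ord.
    by rewrite mulr_natl subrK.
  by congr (_ + _); apply: eq_bigr => q _; rewrite eqxx mul1r; ring.
rewrite (stateD stE) state_Sum big1 ?add0r // => p _.
by rewrite state_Sum big1 // => q _; rewrite (state_rot stE).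
Qed.

Lemma euler_dw (j : nat) e :
  (forall z : 'cV[C]_N, \sum_p conjc (z p 0) * peval (dw p e) z = j%:R * peval e z) ->
  forall p (z : 'cV[C]_N), \sum_q conjc (z q 0) * peval (dw q (dw p e)) z =
    (j%:R - 1) * peval (dw p e) z.
Proof.
move=> eul p z.
have h : peval (Sum (index_enum 'I_N) (fun q => Mul (Wvar _ q) (dw q e))) =1
    peval (Mul (Cst N j%:R) e) by move=> y; rewrite peval_Sum /= -eul.
have := peval_eq_dw p h z; rewrite dw_Sum peval_Sum /= mul0r add0r big_split /=.
rewrite (bigD1 p) //= eqxx mul1r big1 ?addr0; last first.
  by move=> q; rewrite eq_sym => /negPf ->; rewrite mul0r.
move=> h'; rewrite mulrBl mul1r -h' addrAC subrr add0r.
by apply: eq_bigr => q _; rewrite dwC.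
Qed.

End SphereState.

(** * One integration by parts with the tangential gradient bound *)

Section IntegrationByParts.
Variables (R : realType) (N : nat).
Local Notation C := R[i].
Variable E : cpoly R N -> R.
Hypothesis stE : sphere_state E.

(* By Euler's identity the subtracted term is the radial part of [<grad H, grad F>]. *)
Lemma ibp_bound (H H' F P P0 : cpoly R N) (j k l : nat) (b : R) : (0 < j)%N ->
  (forall z : 'cV[C]_N, \sum_p conjc (z p 0) * peval (dw p H) z = j%:R * peval H z) ->
  (forall z : 'cV[C]_N, \sum_p conjc (z p 0) * peval (dw p F) z = k%:R * peval F z) ->
  (forall z, \sum_p peval (dz p (dw p H)) z = peval H' z) ->
  (forall p z, peval (dz p P) z = l%:R * peval P0 z * peval (dz p F) z) ->
  (forall p z, peval (dw p P) z = l%:R * peval P0 z * peval (dw p F) z) ->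
  (forall z, exists2 r : R, 0 <= r & peval P0 z = (r%:C)%C) ->
  (forall z, sqnorm z = 1 -> cmod (\sum_p peval (dw p H) z * peval (dz p F) z
      - j%:R * k%:R * peval H z * peval F z) <= b) ->
  (j * (N + j).-1)%:R * E (Mul H P) - E (Mul H' P) <= l%:R * b * E P0.
Proof.
move=> j0 eulH eulF lapH dzP dwP P0r gam.
pose U := index_enum 'I_N.
pose G := Add (Sum U (fun p => Mul (dw p H) (dz p F)))
  (Mul (Cst N (- (j%:R * k%:R))) (Mul H F)).
have ibp : E (Add (Mul H' P) (Mul (Cst N ((l%:R : R)%:C)%C) (Mul P0 G))) =
    E (Mul (Cst N (((j * (N + j).-1)%:R : R)%:C)%C) (Mul H P)).
  (* [T] cancels the radial correction inside [G] on the left; on the right it is the term coming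
     from the conjugate derivatives of [P], by Euler's identity for [H] and [F]. Both sides are then
     those of [sphere_ibp] for [dw p H] times [P]. *)
  pose T : cpoly R N := Mul (Cst N ((l * j * k)%:R : R)%:C%C) (Mul P0 (Mul H F)).
  apply: (addIr (E T)); rewrite -!(stateD stE).
  transitivity (E (Sum U (fun p => dz p (Mul (dw p H) P)))).
    apply: (state_eq stE) => z z1; rewrite /= !peval_Sum /=.
    under [RHS]eq_bigr => p _ do rewrite dzP mulrA [X in _ + X * _]mulrC -mulrA.
    rewrite big_split /= -mulr_suml -mulr_sumr lapH !rmorph_nat !natrM; ring.
  rewrite (sphere_ibp stE); apply: (state_eq stE) => z z1; rewrite /= !peval_Sum /=.
  transitivity (\sum_p ((N%:R + (j%:R - 1)) * peval P z
      * (conjc (z p 0) * peval (dw p H) z)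
      + l%:R * peval P0 z * (k%:R * peval F z) * (conjc (z p 0) * peval (dw p H) z))).
    apply: eq_bigr => p _; rewrite peval_Sum /=.
    transitivity (N%:R * (conjc (z p 0) * (peval (dw p H) z * peval P z)) +
      \sum_q (conjc (z p 0) * peval P z * (conjc (z q 0) * peval (dw q (dw p H)) z)
       + conjc (z p 0) * peval (dw p H) z * (l%:R * peval P0 z) *
         (conjc (z q 0) * peval (dw q F) z))).
      by congr (_ + _); apply: eq_bigr => q _; rewrite dwP; ring.
    by rewrite big_split /= -!mulr_sumr (euler_dw eulH) eulF; ring.
  rewrite big_split /= -!mulr_sumr eulH.
  have jE : (N + j).-1%:R = N%:R + (j%:R - 1) :> C.
    by rewrite -{2}(prednK j0) -{1}(prednK j0) addnS /= natrD -natr1 addrK.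
  by rewrite !rmorph_nat !natrM jE; ring.
have Gb : E (Mul P0 G) <= b * E P0.
  rewrite -(stateZ stE); apply: (state_mono stE) => z z1.
  apply: le_trans (Re_le_cmod _) _.
  have [r r0 hr] := P0r z; rewrite [peval (Mul _ P0) z]/= hr -rmorphM.
  rewrite [peval _ z]/= hr cmodM cmod_real ger0_norm // mulrC ler_wpM2r //.
  apply: le_trans (gam z z1).
  by rewrite peval_Sum mulNr !mulrA.
move: ibp; rewrite (stateD stE) !(stateZ stE) => <-.
by rewrite addrAC subrr add0r -mulrA ler_wpM2l.
Qed.

End IntegrationByParts.

(** * Moment bounds for the centred form *)

Section Moments.
Variables (R : realType) (N n k : nat).
Local Notation C := R[i].
Variables (Psi : 'I_n -> cpoly R N) (O : 'M[C]_n).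
Hypotheses (N0 : (0 < N)%N) (k0 : (0 < k)%N).
Hypothesis homPsi : homog_block k Psi.
Hypothesis sqPsi : forall z, peval (herm_form 1%:M [:: Psi]) z = sqnorm z ^+ k.
Hypothesis admO : admissible O.
Variable E : cpoly R N -> R.
Hypothesis stE : sphere_state E.

Local Notation h := (level_form Psi O).
Local Notation f := (h 0).

(* [h k] is constant, so the evaluation point [0] is arbitrary. *)
Definition limit_value : R :=
  complex.Re (peval (h k) 0) / (level_cst N k k)%:R.

Definition centered : cpoly R N := Add f (Cst N ((- limit_value)%:C)%C).

Lemma herm_real_Re (x : C) : conjc x = x -> ((complex.Re x)%:C)%C = x.
Proof.
case: x => a b [] /eqP; rewrite -subr_eq0 -opprD oppr_eq0 -mulr2n mulrn_eq0 /=.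
by move=> /eqP ->.
Qed.

Lemma peval_centered z :
  peval centered z = ((complex.Re (peval f z) - limit_value)%:C)%C.
Proof.
have -> : peval centered z = peval f z + ((- limit_value)%:C)%C by [].
by rewrite -[X in X + _](herm_real_Re (level_form_real Psi admO 0 z)) -rmorphD.
Qed.

Lemma dz_centered p z : peval (dz p centered) z = peval (dz p f) z.
Proof. exact: addr0. Qed.

Lemma dw_centered p z : peval (dw p centered) z = peval (dw p f) z.
Proof. exact: addr0. Qed.

Lemma centered_even l z : ~~ odd l ->
  exists2 r : R, 0 <= r & peval (Pow centered l) z = (r%:C)%C.
Proof.
move=> evl; exists ((complex.Re (peval f z) - limit_value) ^+ l).
  exact: exprn_even_ge0.
by rewrite peval_Pow peval_centered rmorphXn.
Qed.

Lemma moment_even_ge0 l : ~~ odd l -> 0 <= E (Pow centered l).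
Proof.
move=> evl; rewrite -(mul0r (E (Pow centered l))) -(stateZ stE).
apply: (state_mono stE) => z z1; have [r r0 hr] := centered_even z evl.
by rewrite [peval (Mul _ _) z]/= hr -rmorphM /= mul0r.
Qed.

(** Dividing by [level_cst] makes consecutive levels comparable: level 0 carries [f] and level [k]
    carries [limit_value], so differences telescope to the centred form. *)
Definition level_moment m l : R :=
  (level_cst N k m)%:R^-1 * E (Mul (h m) (Pow centered l)).

(** This is [ibp_bound] for [h m] against [Y^(l+1)], divided by the next constant. What remains is
    [k / (N + j - 1)] with [j = k - m], at most [k / N]; evenness of [l] keeps [Y^l] nonnegative. *)
Lemma level_moment_step m l : (m < k)%N -> ~~ odd l ->
  level_moment m l.+1 - level_moment m.+1 l.+1 <=
  k%:R / N%:R * l.+1%:R * E (Pow centered l).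
Proof.
move=> mk evl; rewrite /level_moment; set j := (k - m)%N.
have j0 : (0 < j)%N by rewrite subn_gt0.
have := @ibp_bound _ _ _ stE (h m) (h m.+1) f (Pow centered l.+1) (Pow centered l)
  j k l.+1 (level_cst N k m * j * k)%:R j0.
move=> /(_ (fun z => level_euler O homPsi z (ltnW mk))).
have eul0 z := level_euler O homPsi z (leq0n k); rewrite subn0 in eul0.
move=> /(_ eul0 (fun z => level_laplacian O homPsi z (ltnW mk))).
have dzP p z : peval (dz p (Pow centered l.+1)) z =
    l.+1%:R * peval (Pow centered l) z * peval (dz p f) z.
  by rewrite peval_dz_Pow dz_centered peval_Pow.
have dwP p z : peval (dw p (Pow centered l.+1)) z =
    l.+1%:R * peval (Pow centered l) z * peval (dw p f) z.
  by rewrite peval_dw_Pow dw_centered peval_Pow.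
move=> /(_ dzP dwP (fun z => centered_even z evl)).
move=> /(_ (fun z z1 => level_gamma_le N0 homPsi sqPsi admO mk z1)).
have -> : level_cst N k m.+1 = (level_cst N k m * (j * (N + j).-1))%N.
  by rewrite /level_cst big_ord_recr.
have E0 := moment_even_ge0 evl.
set A := E _; set A' := E _; set Z := E _ in E0 *.
have c0 : (0 : R) < (level_cst N k m)%:R by rewrite ltr0n level_cst_gt0 // ltnW.
rewrite !natrM; set c := (level_cst N k m)%:R in c0 *.
have jR0 : (0 : R) < j%:R by rewrite ltr0n.
have kR0 : (0 : R) < k%:R by rewrite ltr0n.
have NR0 : (0 : R) < N%:R by rewrite ltr0n.
have NjR : (N%:R : R) <= (N + j).-1%:R by rewrite ler_nat; lia.
have Nj0 : (0 : R) < (N + j).-1%:R by rewrite (lt_le_trans NR0).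
move: (j%:R : R) (k%:R : R) (N%:R : R) ((N + j).-1%:R : R) (l.+1%:R : R) (ler0n R l.+1)
  jR0 kR0 NR0 NjR Nj0 => J K N' M L L0 J0 K0 N'0 N'M M0 hA.
have -> : c^-1 * A - (c * (J * M))^-1 * A' = (c * (J * M))^-1 * (J * M * A - A').
  by field; rewrite !gt_eqF.
apply: (@le_trans _ _ ((c * (J * M))^-1 * (L * (c * J * K) * Z))).
  by rewrite ler_pM2l // invr_gt0 !mulr_gt0.
have -> : (c * (J * M))^-1 * (L * (c * J * K) * Z) = K / M * L * Z.
  by field; rewrite !gt_eqF.
by rewrite !ler_wpM2r // ler_pM2l // lef_pV2.
Qed.

Lemma moment_recursion l : ~~ odd l ->
  E (Pow centered l.+2) <= k%:R ^+ 2 / N%:R * l.+1%:R * E (Pow centered l).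
Proof.
move=> evl.
have tel m : (m <= k)%N -> level_moment 0 l.+1 - level_moment m l.+1 <=
    m%:R * (k%:R / N%:R * l.+1%:R * E (Pow centered l)).
  elim: m => [|m IHm] mk; first by rewrite subrr mul0r.
  rewrite -(subrKA (level_moment m l.+1)) -natr1 mulrDl mul1r lerD //.
    by rewrite IHm // ltnW.
  exact: level_moment_step.
have -> : E (Pow centered l.+2) = level_moment 0 l.+1 - level_moment k l.+1.
  have c0 : ((level_cst N k k)%:R : R) != 0 by rewrite pnatr_eq0 -lt0n level_cst_gt0.
  have -> : level_moment k l.+1 = limit_value * E (Pow centered l.+1).
    rewrite /level_moment -!(stateZ stE); apply: (state_eq stE) => z _.
    transitivity ((((level_cst N k k)%:R^-1 : R)%:C)%C *
      (peval (h k) z * peval (Pow centered l.+1) z)) => //.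
    rewrite (level_form_const N0 homPsi sqPsi admO).
    rewrite -(herm_real_Re (level_form_real Psi admO k 0)) mulrA -rmorphM.
    by rewrite [_^-1 * _]mulrC.
  rewrite /level_moment /level_cst big_ord0 invr1 mul1r.
  rewrite -mulNr -(stateZ stE) -(stateD stE); apply: (state_eq stE) => z _.
  exact: mulrDl.
apply: le_trans (tel k (leqnn k)) _.
by rewrite le_eqVlt; apply/orP; left; apply/eqP; ring.
Qed.

Lemma moment_bound p :
  E (Pow centered p.*2) <= p`!%:R * (2 * (k%:R ^+ 2 / N%:R)) ^+ p.
Proof.
have K0 : 0 <= k%:R ^+ 2 / N%:R :> R by rewrite divr_ge0 ?sqr_ge0.
elim: p => [|p IHp]; first by rewrite fact0 mul1r expr0 (state1 stE).
rewrite doubleS; apply: le_trans (moment_recursion _) _; first by rewrite odd_double.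
set K := k%:R ^+ 2 / N%:R in K0 IHp *.
(* Relaxing the odd factors of the recursion to even ones turns their product into [2^p p!], which
   suits the exponential series. *)
have hp : (p.*2.+1%:R : R) <= 2 * p.+1%:R by rewrite -natrM ler_nat; lia.
apply: (@le_trans _ _ (K * (2 * p.+1%:R) * (p`!%:R * (2 * K) ^+ p))).
  apply: ler_pM => //; rewrite ?mulr_ge0 //; last by rewrite ler_wpM2l.
  by rewrite moment_even_ge0 // odd_double.
by rewrite le_eqVlt; apply/orP; left; apply/eqP; rewrite factS natrM exprS; ring.
Qed.

End Moments.

(** * From unitary invariance to infinitesimal invariance *)

Section Rotations.
Variables (R : realType) (N : nat).
Local Notation C := R[i].
Implicit Types (e : cpoly R N) (V : 'M[C]_N).

Fixpoint linsubst V e : cpoly R N :=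
  match e with
  | Cst c => Cst N c
  | Zvar p => Sum (index_enum 'I_N) (fun r => Mul (Cst N (V p r)) (Zvar _ r))
  | Wvar p => Sum (index_enum 'I_N) (fun r => Mul (Cst N (conjc (V p r))) (Wvar _ r))
  | Add a b => Add (linsubst V a) (linsubst V b)
  | Mul a b => Mul (linsubst V a) (linsubst V b)
  end.

Lemma peval_linsubst V e z : peval (linsubst V e) z = peval e (V *m z).
Proof.
elim: e => [c|p|p|a IHa b IHb|a IHa b IHb] //=; rewrite ?IHa ?IHb // peval_Sum mxE //.
by rewrite conjc_sum; apply: eq_bigr => r _; rewrite rmorphM.
Qed.

Lemma sqnorm1_cbounded (z : 'cV[C]_N) : sqnorm z = 1 -> cbounded 1 z.
Proof.
move=> z1 p; rewrite -(@ler_pXn2r _ 2) ?nnegrE ?cmod_ge0 // expr1n -lecR.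
have <- : ((\sum_p cmod (z p 0) ^+ 2)%:C)%C = (1 : R)%:C%C.
  by rewrite real_complex_sum -[RHS]z1; apply: eq_bigr => q _; rewrite cmod_sqr.
by rewrite lecR (bigD1 p) //= lerDl sumr_ge0 // => q _; rewrite sqr_ge0.
Qed.

(* The rotation [1 + (w - 1) P] about a projector [P] by the phase
   [w = (1 + t) / (1 - t)], [t] imaginary. *)
Definition phase1 (t : C) : C := 2 * t / (1 - t).

(** For imaginary [t] the phase [w] has modulus 1, and the coefficient of [P] in the product is
    [|w|^2 - 1]. *)
Lemma unitary_phase (P : 'M[C]_N) (t : C) :
  adjmx P = P -> P *m P = P -> conjc t = - t -> 1 - t != 0 -> 1 + t != 0 ->
  unitary (1%:M + phase1 t *: P).
Proof.
move=> hP PP ht t1 t2; rewrite /unitary.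
have -> : adjmx (1%:M + phase1 t *: P) = 1%:M + conjc (phase1 t) *: P.
  apply/matrixP => i j; rewrite !mxE rmorphD rmorphM /= -{2}hP mxE; congr (_ + _).
  by rewrite eq_sym conjc_nat.
rewrite mulmxDl !mulmxDr !mul1mx mulmx1 -scalemxAl -scalemxAr PP scalerA addrA.
have -> : conjc (phase1 t) = - (2 * t) / (1 + t).
  by rewrite /phase1 !(rmorphM, fmorphV, rmorphB) /= rmorph1 ht conjc_nat opprK mulrN.
rewrite -!addrA -!scalerDl [X in X *: P](_ : _ = 0) ?scale0r ?addr0 //.
by rewrite /phase1; field; rewrite t1 t2.
Qed.

Variable E : cpoly R N -> R.
Hypothesis ED : forall a b, E (Add a b) = E a + E b.
Hypothesis EZ : forall (r : R) a, E (Mul (Cst N (r%:C)%C) a) = r * E a.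
Hypothesis Emono : forall a b,
  (forall z, sqnorm z = 1 -> complex.Re (peval a z) <= complex.Re (peval b z)) ->
  E a <= E b.
Hypothesis E1 : E (Cst N 1) = 1.
Hypothesis Einv : forall V e, unitary V -> E (linsubst V e) = E e.

Let Eeq a b : (forall z, sqnorm z = 1 -> peval a z = peval b z) -> E a = E b.
Proof. by move=> ab; apply/eqP; rewrite eq_le !Emono // => z /ab ->. Qed.

(** Rotate by the phase with [t = i s]: then [V z = z + 2 i s P z] up to order [s ^+ 2]. Invariance
    cancels [e] after rotation against [e], so [s * E e'] is of order [s ^+ 2] and must vanish. *)
Lemma phase_derivative (P : 'M[C]_N) e e' : adjmx P = P -> P *m P = P ->
  (forall z, peval e' z = dirD ((2 * 'i%C) *: (P *m z)) e z) -> E e' = 0.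
Proof.
move=> hP PP he'.
pose b : R := \sum_p \sum_r cmod (P p r).
have b0 : 0 <= b by do 2!(rewrite sumr_ge0 // => ? _); exact: cmod_ge0.
have Pz z p : sqnorm z = 1 -> cmod ((P *m z) p 0) <= b.
  move=> /sqnorm1_cbounded hz; rewrite mxE (le_trans (cmod_sum _ _)) //.
  apply: (@le_trans _ _ (\sum_r cmod (P p r))); last first.
    rewrite /b [leRHS](bigD1 p) //= lerDl.
    by do 2!(rewrite sumr_ge0 // => ? _); exact: cmod_ge0.
  by apply: ler_sum => r _; rewrite cmodM ler_piMr ?cmod_ge0.
(* The constant [1 + 2 * b] dominates the coordinates of [z], of [V z] and of the direction, as well
   as the second-order error of the curve. *)
have [K K0 hK] := taylor1 e (1 + 2 * b).
suff : ((E e')%:C)%C = 0 by case.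
apply: (@small_quadratic_eq0 _ _ K) => s /[dup] hs /andP[s0 s1].
rewrite -(rmorphM (real_complex R)) cmod_real ler_norml.
have [t tdef] : exists t : C, t = 'i%C * (s%:C)%C by exists ('i%C * (s%:C)%C).
have tE : t = (0 +i* s)%C by rewrite tdef; simpc.
have ht : conjc t = - t by rewrite tE; apply/eqP; rewrite eq_complex /= oppr0 !eqxx.
have t1 : 1 - t != 0 by rewrite tE eq_complex /= subr0 oner_eq0.
have t2 : 1 + t != 0 by rewrite tE eq_complex /= addr0 oner_eq0.
have inv1 : cmod (1 - t)^-1 <= 1.
  rewrite /cmod ComplexField.Normc.normcV invf_le1; last first.
    by rewrite lt_def (cmod_ge0 (1 - t)) andbT; apply: contraNN t1 => /eqP/cmod0_eq0 ->.
  rewrite (le_trans _ (Re_le_cmod (1 - t))) // tE /= subr0 //.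
pose V := 1%:M + phase1 t *: P.
have uV : unitary V by exact: unitary_phase.
have cmod2 : cmod (2 : C) = 2.
  by rewrite (_ : (2 : C) = ((2 : R)%:C)%C) ?cmod_real ?normr_nat // rmorph_nat.
have cmodi : cmod 'i%C = 1 :> R by rewrite /cmod /= expr0n /= add0r expr1n sqrtr1.
have cmodt : cmod t = s by rewrite tdef cmodM cmodi mul1r cmod_real gtr0_norm.
have ph : cmod (phase1 t) <= 2 * s.
  by rewrite !cmodM cmod2 cmodt ler_piMr // mulr_ge0 // ltW.
have est z : sqnorm z = 1 ->
    cmod (peval e (V *m z) - peval e z - (s%:C)%C * peval e' z) <= K * s ^+ 2.
  move=> z1; have hz := sqnorm1_cbounded z1.
  have Vz p : (V *m z) p 0 = z p 0 + phase1 t * (P *m z) p 0.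
    by rewrite mulmxDl mul1mx -scalemxAl !mxE.
  rewrite he'; apply: hK => // p.
  - by rewrite (le_trans (hz p)) // lerDl mulr_ge0.
  - rewrite Vz (le_trans (cmodD _ _)) // lerD ?hz // cmodM ler_pM ?cmod_ge0 ?Pz //.
    by rewrite (le_trans ph) // -[leRHS]mulr1 ler_pM2l.
  - rewrite mxE !cmodM cmod2 cmodi mulr1 (@le_trans _ _ (2 * b)) ?lerDr //.
    by rewrite ler_pM2l // Pz.
  have -> : ((2 * 'i%C) *: (P *m z)) p 0 = 2 * 'i%C * (P *m z) p 0 by exact: mxE.
  rewrite Vz.
  have -> : z p 0 + phase1 t * (P *m z) p 0 - z p 0 -
      (s%:C)%C * (2 * 'i%C * (P *m z) p 0) = 2 * t * t * (1 - t)^-1 * (P *m z) p 0.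
    have -> : (s%:C)%C * (2 * 'i%C * (P *m z) p 0) = 2 * t * (P *m z) p 0.
      by rewrite tdef; ring.
    by rewrite /phase1; field.
  rewrite !cmodM cmod2 cmodt; apply: (@le_trans _ _ (2 * s * s * b)).
    by rewrite ler_pM ?mulr_ge0 ?cmod_ge0 ?(ltW s0) ?Pz // ler_piMr // !mulr_ge0 ?(ltW s0).
  have -> : 2 * s * s * b = 2 * b * s ^+ 2 by ring.
  by rewrite ler_wpM2r ?sqr_ge0 // lerDr.
have Ereal (r : R) : E (Cst N (r%:C)%C) = r.
  by rewrite -[RHS]mulr1 -E1 -EZ; apply: Eeq => z _ /=; rewrite mulr1.
(* The Taylor remainder as a polynomial: its values on the sphere are bounded by [K * s ^+ 2], and
   under [E] only the [e'] term survives. *)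
pose T := Add (Add (linsubst V e) (Mul (Cst N ((-1 : R)%:C)%C) e)) (Mul (Cst N ((- s)%:C)%C) e').
have ET : E T = - (s * E e').
  by rewrite !ED !EZ Einv // mulN1r subrr add0r mulNr.
have Tz z : sqnorm z = 1 -> cmod (peval T z) <= K * s ^+ 2.
  move=> /est; rewrite /T /= peval_linsubst; congr (cmod _ <= _).
  by rewrite !rmorphN rmorph1; ring.
apply/andP; split.
  rewrite lerNl -ET -[leRHS]Ereal; apply: Emono => z z1.
  by rewrite (le_trans (Re_le_cmod _)) // Tz.
have -> : s * E e' = E (Mul (Cst N ((-1 : R)%:C)%C) T) by rewrite EZ ET mulN1r opprK.
rewrite -[leRHS]Ereal; apply: Emono => z z1.
rewrite (le_trans (Re_le_cmod _)) //.
have -> : peval (Mul (Cst N ((-1 : R)%:C)%C) T) z = ((-1 : R)%:C)%C * peval T z by [].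
by rewrite cmodM cmod_real normrN1 mul1r Tz.
Qed.

(** The sum is the derivative along the rotation about the line of [v]. A complex [c] is allowed
    although [E] is only real-linear, because the factor is absorbed into the polynomial being
    differentiated. *)
Lemma rank1_derivative (v : 'cV[C]_N) (c : C) e : sqnorm v != 0 ->
  E (Sum (index_enum 'I_N) (fun p => Sum (index_enum 'I_N) (fun r =>
    Mul (Cst N (c * (v p 0 * conjc (v r 0)))) (rot_field p r e)))) = 0.
Proof.
move=> v0; pose P : 'M[C]_N := (sqnorm v)^-1 *: (v *m adjmx v).
have vv : adjmx v *m v = (sqnorm v)%:M.
  apply/matrixP => i j; rewrite !ord1 !mxE mulr1n; apply: eq_bigr => p _.
  by rewrite mxE mulrC.
have cn : conjc (sqnorm v) = sqnorm v.
  by rewrite conjc_sum; apply: eq_bigr => p _; rewrite rmorphM /= conjcK mulrC.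
have hP : adjmx P = P.
  apply/matrixP => i j; rewrite !mxE !big_ord1 !mxE !rmorphM /= conjcK fmorphV /= cn.
  by rewrite [v i 0 * _]mulrC.
have PP : P *m P = P.
  rewrite -scalemxAl -scalemxAr scalerA mulmxA -[_ *m v]mulmxA vv mul_mx_scalar.
  by rewrite -scalemxAl scalerA mulfVK.
have i0 : ('i%C : C) != 0 by rewrite eq_complex /= oner_eq0 andbF.
have ci : conjc 'i%C = - 'i%C :> C by apply/eqP; rewrite eq_complex /= oppr0 !eqxx.
have Pz z p : (P *m z) p 0 = (sqnorm v)^-1 * (v p 0 * \sum_r conjc (v r 0) * z r 0).
  rewrite -scalemxAl mxE -mulmxA mxE big_ord1; congr (_ * (_ * _)).
  by rewrite mxE; apply: eq_bigr => r _; rewrite mxE.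
pose d := c * sqnorm v / (2 * 'i%C).
apply: (phase_derivative (e := Mul (Cst N d) e) hP PP) => z.
rewrite /dirD big_split /= peval_Sum.
transitivity (\sum_p \sum_r (c * (v p 0 * conjc (v r 0)) * (z r 0 * peval (dz p e) z)) +
    \sum_p \sum_r (c * (v p 0 * conjc (v r 0)) * (- (conjc (z p 0) * peval (dw r e) z)))).
  rewrite -big_split; apply: eq_bigr => p _; rewrite peval_Sum -big_split.
  by apply: eq_bigr => r _ /=; ring.
congr (_ + _).
  apply: eq_bigr => p _; rewrite mxE Pz.
  transitivity (c * (v p 0 * (\sum_r conjc (v r 0) * z r 0)) * peval (dz p e) z).
    rewrite mulr_sumr mulr_sumr mulr_suml; apply: eq_bigr => r _; ring.
  by rewrite /d; field; rewrite i0 v0.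
rewrite exchange_big; apply: eq_bigr => p _; rewrite mxE Pz.
rewrite !rmorphM /= ci conjc_nat fmorphV /= cn conjc_sum.
transitivity (- (c * (conjc (v p 0) * (\sum_r v r 0 * conjc (z r 0))) * peval (dw p e) z)).
  rewrite mulr_sumr mulr_sumr mulr_suml -sumrN; apply: eq_bigr => r _; ring.
under [X in _ = _ * (_ * (_ * X)) * _]eq_bigr do rewrite rmorphM /= conjcK.
by rewrite /d; field; rewrite i0 v0.
Qed.

Lemma sum_two_deltas (p q : 'I_N) (a b : C) (F : 'I_N -> C) :
  \sum_r (a * (r == p)%:R + b * (r == q)%:R) * F r = a * F p + b * F q.
Proof.
under eq_bigr do rewrite mulrDl; rewrite big_split /=; congr (_ + _).
  rewrite (bigD1 p) //= eqxx mulr1 big1 ?addr0 // => r /negPf ->.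
  by rewrite mulr0 mul0r.
rewrite (bigD1 q) //= eqxx mulr1 big1 ?addr0 // => r /negPf ->.
by rewrite mulr0 mul0r.
Qed.

(** The case [v = a e_p + b e_q] of [rank1_derivative]; the hypothesis says that the coordinate
    [v_q] is nonzero, in a form that also covers [p = q]. *)
Lemma two_point_derivative (p q : 'I_N) (a b c : C) e :
  a * (q == p)%:R + b != 0 ->
  E (Mul (Cst N (c * (a * conjc a))) (rot_field p p e)) +
  E (Mul (Cst N (c * (a * conjc b))) (rot_field p q e)) +
  E (Mul (Cst N (c * (b * conjc a))) (rot_field q p e)) +
  E (Mul (Cst N (c * (b * conjc b))) (rot_field q q e)) = 0.
Proof.
move=> hab; pose v : 'cV[C]_N := \col_r (a * (r == p)%:R + b * (r == q)%:R).
have v0 : sqnorm v != 0.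
  have -> : sqnorm v = ((\sum_r cmod (v r 0) ^+ 2)%:C)%C.
    by rewrite real_complex_sum; apply: eq_bigr => r _; rewrite cmod_sqr.
  rewrite eq_complex /= eqxx andbT psumr_eq0 => [|r _]; last exact: sqr_ge0.
  apply/allPn; exists q; rewrite ?mem_index_enum // sqrf_eq0 mxE eqxx mulr1.
  by apply: contraNN hab => /eqP/cmod0_eq0 ->.
rewrite -[RHS](rank1_derivative c e v0) -!ED; apply: Eeq => z _.
rewrite peval_Sum.
transitivity (c * \sum_p' v p' 0 * \sum_r conjc (v r 0) * peval (rot_field p' r e) z).
  under eq_bigr do rewrite mxE.
  rewrite sum_two_deltas.
  have h p' : \sum_r conjc (v r 0) * peval (rot_field p' r e) z =
      conjc a * peval (rot_field p' p e) z + conjc b * peval (rot_field p' q e) z.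
    rewrite -(sum_two_deltas p q (conjc a) (conjc b) (fun r => peval (rot_field p' r e) z)).
    apply: eq_bigr => r _.
    by rewrite mxE rmorphD !rmorphM /= !conjc_nat.
  by rewrite !h /=; ring.
rewrite mulr_sumr; apply: eq_bigr => p' _; rewrite peval_Sum !mulr_sumr.
by apply: eq_bigr => r _; rewrite /=; ring.
Qed.

(* Polarisation of [v |-> sum v_p conj(v_r) rot_field p r] at [e_p], [e_p + e_q], [i e_p + e_q]. *)
Lemma invariant_state_rot p q e : E (rot_field p q e) = 0.
Proof.
have E0 a : E (Mul (Cst N 0) a) = 0 by rewrite -[0 in LHS]/((0 : R)%:C)%C EZ mul0r.
have diag r c : E (Mul (Cst N c) (rot_field r r e)) = 0.
  have := @two_point_derivative r r 0 1 c e.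
  by rewrite !(mul0r, add0r, mulr0, mulr1, conjc0, conjc1) oner_neq0 !E0 !add0r => /(_ isT).
have plus c : E (Mul (Cst N c) (rot_field p q e)) + E (Mul (Cst N c) (rot_field q p e)) = 0.
  have := @two_point_derivative p q 1 1 c e.
  rewrite !conjc1 !mulr1 !diag add0r addr0; apply.
  by case: (q == p); rewrite /= ?mulr0 ?mulr1 ?add0r ?oner_neq0 // -mulr2n pnatr_eq0.
have ci : conjc 'i%C = - 'i%C :> C by apply/eqP; rewrite eq_complex /= oppr0 !eqxx.
(* With [a = i], [b = 1] and [c = - i] the two cross coefficients are 1 and -1; combined with [plus]
   this isolates each field. *)
have minus : E (Mul (Cst N 1) (rot_field p q e)) + E (Mul (Cst N (-1)) (rot_field q p e)) = 0.
  have := @two_point_derivative p q 'i%C 1 (- 'i%C) e.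
  rewrite !diag add0r addr0 ci conjc1 mulr1 mul1r mulrNN mulNr -expr2 sqr_i opprK; apply.
  rewrite eq_complex /=; case: (q == p); rewrite /= ?mulr0 ?mul0r ?mulr1 ?mul1r ?subr0.
    by rewrite !addr0 add0r oner_eq0 andbF.
  by rewrite !(mulr0, mul0r, addr0, add0r, subr0) oner_eq0.
have En a : E (Mul (Cst N (-1)) a) = - E a.
  by rewrite -(_ : (((-1 : R)%:C)%C = -1)) ?EZ ?mulN1r // rmorphN rmorph1.
have e1 a : E (Mul (Cst N 1) a) = E a.
  by apply: Eeq => z _; exact: mul1r.
have := plus 1; move: minus; rewrite !e1 En => /eqP; rewrite subr_eq0 => /eqP <-.
by rewrite -mulr2n => /eqP; rewrite mulrn_eq0 => /eqP.
Qed.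

End Rotations.

(** * Haar measure as a state on the sphere *)

Section HaarState.
Variables (R : realType) (N : nat).
Local Notation C := R[i].
Local Notation MM := (MatMeas R N).
Implicit Types (F G : MM -> C) (e : cpoly R N).

Definition cmeasurable F : Prop :=
  measurable_fun [set: MM] (fun U => complex.Re (F U)) /\
  measurable_fun [set: MM] (fun U => complex.Im (F U)).

Lemma cmeasurable_entry i j : cmeasurable (fun U : MM => (U : 'M[C]_N) i j).
Proof.
by split=> _ B mB; rewrite setTI; apply: sub_sigma_algebra; exists i, j, B; split=> //;
  [left|right].
Qed.

Lemma cmeasurable_cst (c : C) : cmeasurable (fun=> c).
Proof. by split; exact: measurable_cst. Qed.

Lemma cmeasurableD F G : cmeasurable F -> cmeasurable G ->
  cmeasurable (fun U => F U + G U).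
Proof.
move=> [Fr Fi] [Gr Gi]; split.
  apply: (@eq_measurable_fun _ _ _ _ _ (fun U => complex.Re (F U) + complex.Re (G U))).
    by move=> U _; case: (F U) => ? ?; case: (G U).
  exact: measurable_funD.
apply: (@eq_measurable_fun _ _ _ _ _ (fun U => complex.Im (F U) + complex.Im (G U))).
  by move=> U _; case: (F U) => ? ?; case: (G U).
exact: measurable_funD.
Qed.

Lemma cmeasurableM F G : cmeasurable F -> cmeasurable G ->
  cmeasurable (fun U => F U * G U).
Proof.
move=> [Fr Fi] [Gr Gi]; split.
  apply: (@eq_measurable_fun _ _ _ _ _ (fun U => complex.Re (F U) * complex.Re (G U)
    - complex.Im (F U) * complex.Im (G U))).
    by move=> U _; case: (F U) => ? ?; case: (G U).
  by apply: measurable_funB; exact: measurable_funM.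
apply: (@eq_measurable_fun _ _ _ _ _ (fun U => complex.Re (F U) * complex.Im (G U)
    + complex.Im (F U) * complex.Re (G U))).
  by move=> U _; case: (F U) => ? ?; case: (G U).
by apply: measurable_funD; exact: measurable_funM.
Qed.

Lemma cmeasurableJ F : cmeasurable F -> cmeasurable (fun U => conjc (F U)).
Proof.
move=> [Fr Fi]; split.
  by apply: (@eq_measurable_fun _ _ _ _ _ (fun U => complex.Re (F U))) => // U _; case: (F U).
apply: (@eq_measurable_fun _ _ _ _ _ (fun U => - complex.Im (F U))).
  by move=> U _; case: (F U).
exact: measurable_funN.
Qed.

Lemma cmeasurable_sum (I : Type) (s : seq I) (F : I -> MM -> C) :
  (forall i, cmeasurable (F i)) -> cmeasurable (fun U => \sum_(i <- s) F i U).
Proof.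
move=> mF; elim: s => [|i s IHs].
  by under eq_fun do rewrite big_nil; exact: cmeasurable_cst.
by under eq_fun do rewrite big_cons; exact: cmeasurableD.
Qed.

Definition first_col (U : MM) : 'cV[C]_N := (U : 'M[C]_N) *m @ket0 R N.

Lemma cmeasurable_first_col p : cmeasurable (fun U => first_col U p 0).
Proof.
under eq_fun do rewrite mxE; apply: cmeasurable_sum => i.
by apply: cmeasurableM; [exact: cmeasurable_entry|exact: cmeasurable_cst].
Qed.

Lemma cmeasurable_peval e : cmeasurable (fun U => peval e (first_col U)).
Proof.
elim: e => [c|p|p|a IHa b IHb|a IHa b IHb] /=.
- exact: cmeasurable_cst.
- exact: cmeasurable_first_col.
- exact/cmeasurableJ/cmeasurable_first_col.
- exact: cmeasurableD.
- exact: cmeasurableM.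
Qed.

Definition unitaries : set MM := [set U : MM | unitary (U : 'M[C]_N)].

Lemma measurable_unitaries : measurable unitaries.
Proof.
pose F (ij : 'I_N * 'I_N) (U : MM) : C := (adjmx (U : 'M[C]_N) *m (U : 'M[C]_N)) ij.1 ij.2.
have mF ij : cmeasurable (F ij).
  rewrite /F; under eq_fun do rewrite mxE; apply: cmeasurable_sum => r.
  apply: cmeasurableM; last exact: cmeasurable_entry.
  by under eq_fun do rewrite mxE; exact/cmeasurableJ/cmeasurable_entry.
have -> : unitaries = \bigcap_(ij in [set: 'I_N * 'I_N])
    ((fun U => complex.Re (F ij U)) @^-1` [set complex.Re ((1%:M : 'M[C]_N) ij.1 ij.2)] `&`
     (fun U => complex.Im (F ij U)) @^-1` [set complex.Im ((1%:M : 'M[C]_N) ij.1 ij.2)]).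
  apply/seteqP; split => U /=.
    by move=> uU [i j] _ /=; rewrite /F /= uU.
  move=> h; apply/matrixP => i j; have [/= h1 h2] := h (i, j) I.
  by move: h1 h2; rewrite /F /=; case: (_ i j) => ? ?; case: (_ i j) => ? ? /= -> ->.
apply: fin_bigcap_measurable => // ij _; have [mr mi] := mF ij.
by apply: measurableI; [rewrite -[X in measurable X]setTI; apply: mr
  | rewrite -[X in measurable X]setTI; apply: mi].
Qed.

Lemma measurable_mulmxl (V : 'M[C]_N) :
  measurable_fun [set: MM] (fun U : MM => (V *m (U : 'M[C]_N) : MM)).
Proof.
apply: (@measurability _ _ MM MM setT _ (@entry_sets R N)) => //.
move=> _ [S [i [j [B [mB hB]]]] <-].
have [mr mi] : cmeasurable (fun U : MM => (V *m (U : 'M[C]_N)) i j).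
  under eq_fun do rewrite mxE; apply: cmeasurable_sum => r.
  by apply: cmeasurableM; [exact: cmeasurable_cst|exact: cmeasurable_entry].
by case: hB => ->; [exact: mr|exact: mi].
Qed.

Variables (mu : probability MM R).
Hypotheses (N0 : (0 < N)%N) (hmu : is_haar mu).

Lemma sqnorm_first_col (U : MM) : unitaries U -> sqnorm (first_col U) = 1.
Proof.
move=> uU; have sq (z : 'cV[C]_N) : sqnorm z = (adjmx z *m z) 0 0.
  by rewrite mxE; apply: eq_bigr => p _; rewrite mxE mulrC.
have adjM m n p (A : 'M[C]_(m, n)) (B : 'M[C]_(n, p)) : adjmx (A *m B) = adjmx B *m adjmx A.
  apply/matrixP => i j; rewrite !mxE conjc_sum; apply: eq_bigr => r _.
  by rewrite !mxE rmorphM /= mulrC.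
rewrite sq /first_col adjM mulmxA -(mulmxA (adjmx (ket0 R N))) uU mulmx1 mxE.
rewrite (bigD1 (Ordinal N0)) //= !mxE /= conjc_nat mulr1 big1 ?addr0 //.
by move=> [[|i] hi] //= _; rewrite !mxE /= mulr0.
Qed.

(** Restricting to the unitaries, a set of full measure, keeps the first column on the sphere and
    the integrand bounded. *)
Definition haar_state e : R := (\int[mu]_(U in unitaries) complex.Re (peval e (first_col U)))%R.

Lemma mu_unitaries : mu unitaries = 1%E.
Proof. by case: hmu. Qed.

Lemma haar_integrable e :
  mu.-integrable unitaries (EFin \o (fun U => complex.Re (peval e (first_col U)))).
Proof.
apply: measurable_bounded_integrable => //; first exact: measurable_unitaries.
- by rewrite [X in (X < _)%E]mu_unitaries ltry.
- by apply: measurable_funTS; case: (cmeasurable_peval e).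
have [K K0 hK] := peval_bounded e 1.
exists K; split; first exact: num_real.
move=> M KM U uU /=; apply: ltW; apply: le_lt_trans KM.
rewrite (le_trans _ (hK _ (sqnorm1_cbounded (sqnorm_first_col uU)))) //.
by rewrite -lecR cmod_norm; exact: normc_ge_Re.
Qed.

(** Change of variables [U] to [V U]: it preserves the measure and the unitaries, and multiplies the
    first column by [V]. *)
Lemma haar_state_invariant (V : 'M[C]_N) e : unitary V ->
  haar_state (linsubst V e) = haar_state e.
Proof.
move=> uV; rewrite /haar_state /Rintegral.
pose phi (U : MM) : MM := V *m (U : 'M[C]_N).
have phiD : phi @^-1` unitaries = unitaries.
  have aux (U : MM) : adjmx (phi U : 'M[C]_N) *m (phi U : 'M[C]_N)
     = adjmx (U : 'M[C]_N) *m (U : 'M[C]_N).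
    rewrite /phi; have -> : adjmx (V *m (U : 'M[C]_N)) = adjmx (U : 'M[C]_N) *m adjmx V.
      apply/matrixP => i j; rewrite !mxE conjc_sum; apply: eq_bigr => r _.
      by rewrite !mxE rmorphM /= mulrC.
    by rewrite mulmxA -(mulmxA _ (adjmx V)) uV mulmx1.
  by apply/seteqP; split => U; rewrite /unitaries /= /unitary aux.
have mphi : measurable_fun [set: MM] phi by exact: measurable_mulmxl.
pose g (U : MM) : \bar R := (complex.Re (peval e (first_col U)))%:E.
have mg : measurable_fun [set: MM] g.
  by apply/measurable_EFinP; case: (cmeasurable_peval e).
have gphi : (g \o phi) = (fun U => (complex.Re (peval (linsubst V e) (first_col U)))%:E).
  by apply/funext => U; rewrite /g /= peval_linsubst /first_col mulmxA.
congr fine.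
have := integral_pushforward mphi (mu := mu) (D := unitaries) mg.
rewrite phiD gphi => /(_ (haar_integrable _) measurable_unitaries) <-.
by apply: eq_measure_integral => A mA _; case: hmu => _ /(_ V uV A mA).
Qed.

Lemma haar_sphere_state : sphere_state haar_state.
Proof.
have mD := measurable_unitaries.
have hD a b : haar_state (Add a b) = haar_state a + haar_state b.
  rewrite /haar_state -RintegralD //; try exact: haar_integrable.
  by apply: eq_Rintegral => U _ /=; case: (peval a _) => ? ?; case: (peval b _).
have hZ r a : haar_state (Mul (Cst N (r%:C)%C) a) = r * haar_state a.
  rewrite /haar_state -RintegralZl //; last exact: haar_integrable.
  by apply: eq_Rintegral => U _ /=; case: (peval a _) => ? ? /=; rewrite mul0r subr0.
have hm a b : (forall z, sqnorm z = 1 ->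
    complex.Re (peval a z) <= complex.Re (peval b z)) -> haar_state a <= haar_state b.
  move=> ab; apply: le_Rintegral => //; try exact: haar_integrable.
  by move=> U /sqnorm_first_col /ab.
have h1 : haar_state (Cst N 1) = 1.
  by rewrite /haar_state /= Rintegral_cst // [X in fine X]mu_unitaries mul1r.
split=> // p q a.
exact: (invariant_state_rot hD hZ hm h1 (fun V e => @haar_state_invariant V e)).
Qed.

(** Markov's inequality; [A] may be cut down to the unitaries, whose complement is null. *)
Lemma haar_markov e (A : set MM) (c : R) : measurable A -> 0 <= c ->
  (forall z, sqnorm z = 1 -> 0 <= complex.Re (peval e z)) ->
  (forall U, unitaries U -> A U -> c <= complex.Re (peval e (first_col U))) ->
  (c%:E * mu A <= (haar_state e)%:E)%E.
Proof.
move=> mA c0 e0 ec.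
have mD := measurable_unitaries.
have mu0 : mu (~` unitaries) = 0%E by rewrite probability_setC // mu_unitaries subee.
have -> : mu A = mu (A `&` unitaries).
  rewrite (measureDI mu mA mD) [X in (X + _)%E = _](_ : _ = 0%E) ?add0e //.
  apply: (@subset_measure0 _ _ _ mu _ (~` unitaries)) => //.
  - exact: measurableD.
  - exact: measurableC.
have mI : measurable (A `&` unitaries) by exact: measurableI.
pose g (U : MM) : \bar R := (complex.Re (peval e (first_col U)))%:E.
have mg : measurable_fun [set: MM] g.
  by apply/measurable_EFinP; case: (cmeasurable_peval e).
have -> : (haar_state e)%:E = (\int[mu]_(U in unitaries) g U)%E.
  rewrite /haar_state /Rintegral fineK //.
  by apply: integrable_fin_num => //; exact: haar_integrable.
rewrite -integral_cst //.
apply: (@le_trans _ _ (\int[mu]_(U in A `&` unitaries) g U)%E).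
  apply: ge0_le_integral => //.
  - by apply: measurable_funTS.
  - by move=> U [AU uU]; rewrite lee_fin ec.
apply: ge0_subset_integral => //.
- by apply: measurable_funTS.
- by move=> U uU; rewrite lee_fin e0 // sqnorm_first_col.
Qed.

End HaarState.

Lemma ReC (R : realType) (r : R) : complex.Re (r%:C)%C = r.
Proof. by []. Qed.

(** * Tensor powers of the state as blocks of monomials *)

Section TensorPower.
Variables (R : realType) (N : nat).
Local Notation C := R[i].

(** The coordinates of the [k.+1]-fold tensor power of [z], indexed as in [ntensmx]; one factor is
    the base case. *)
Fixpoint tens_monomial k : 'I_(N ^ k.+1) -> cpoly R N :=
  match k return 'I_(N ^ k.+1) -> cpoly R N with
  | 0 => fun x : 'I_N => Zvar R x
  | k'.+1 => fun x : 'I_(N * N ^ k'.+1) =>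
      Mul (Zvar R (mxtens_unindex x).1) (tens_monomial (mxtens_unindex x).2)
  end.

Lemma holo_tens_monomial k (x : 'I_(N ^ k.+1)) : holo (tens_monomial x).
Proof. by elim: k x => [|k IHk] x /=. Qed.

Lemma euler_tens_monomial k (x : 'I_(N ^ k.+1)) (z : 'cV[C]_N) :
  \sum_p z p 0 * peval (dz p (tens_monomial x)) z = k.+1%:R * peval (tens_monomial x) z.
Proof.
have delta (y : 'I_N) (c : C) : \sum_p z p 0 * ((p == y)%:R * c) = z y 0 * c.
  rewrite (bigD1 y) //= eqxx mul1r big1 ?addr0 // => p /negPf ->.
  by rewrite mul0r mulr0.
elim: k x => [|k IHk] x.
  by rewrite mul1r -[RHS]mulr1 -delta; apply: eq_bigr => p _ /=; rewrite mulr1.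
rewrite -[tens_monomial x]/(Mul (Zvar R (mxtens_unindex (x : 'I_(N * N ^ k.+1))).1)
  (tens_monomial (mxtens_unindex (x : 'I_(N * N ^ k.+1))).2)).
move: (mxtens_unindex _) => [y w]; have IH := IHk w; rewrite /=.
under eq_bigr do rewrite mulrDr; rewrite big_split /= delta.
transitivity (z y 0 * peval (tens_monomial w) z
  + z y 0 * \sum_p z p 0 * peval (dz p (tens_monomial w)) z).
  by congr (_ + _); rewrite mulr_sumr; apply: eq_bigr => p _; rewrite mulrCA.
by rewrite IH -[k.+2%:R]natr1; ring.
Qed.

Lemma homog_tens_monomial k : homog_block k.+1 (@tens_monomial k).
Proof.
split=> [x|x z]; [exact: holo_tens_monomial | exact: euler_tens_monomial].
Qed.

Lemma sqnorm_tens_monomial k (z : 'cV[C]_N) :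
  peval (herm_form 1%:M [:: @tens_monomial k]) z = sqnorm z ^+ k.+1.
Proof.
rewrite herm_form1 big_seq1 real_complex_sum.
under eq_bigr do rewrite cmod_sqr.
elim: k => [|k IHk]; first by rewrite expr1.
rewrite exprS -IHk /sqnorm mulr_sum; apply: eq_bigr => x _ /=.
by rewrite rmorphM /=; ring.
Qed.

Lemma rhoU_entry (U : MatMeas R N) x y :
  rhoU (U : 'M[C]_N) x y = first_col U x 0 * conjc (first_col U y 0).
Proof.
rewrite /rhoU !mulmxA -[U *m _]/(first_col U) -mulmxA mxE big_ord1.
congr (_ * _).
rewrite -[adjmx _ *m _](_ : adjmx (first_col U) = _) ?mxE //.
apply/matrixP => i j; rewrite !mxE conjc_sum; apply: eq_bigr => r _.
by rewrite !mxE rmorphM /= mulrC.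
Qed.

Lemma ntensmx_rhoU_entry k (U : MatMeas R N) (x y : 'I_(N ^ k.+1)) :
  ntensmx (rhoU (U : 'M[C]_N)) k.+1 x y =
  peval (tens_monomial x) (first_col U) * conjc (peval (tens_monomial y) (first_col U)).
Proof.
elim: k x y => [|k IHk] x y; first exact: rhoU_entry.
rewrite ntensmxSS mxE rhoU_entry IHk /= rmorphM /=; ring.
Qed.

Lemma trace_ntensmx_rhoU k (U : MatMeas R N) (O : 'M[C]_(N ^ k.+1)) :
  \tr (ntensmx (rhoU (U : 'M[C]_N)) k.+1 *m O) =
  peval (herm_form O [:: @tens_monomial k]) (first_col U).
Proof.
rewrite peval_herm_form big_seq1 exchange_big /=; apply: eq_bigr => x _.
rewrite mxE; apply: eq_bigr => y _; rewrite ntensmx_rhoU_entry; ring.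
Qed.

End TensorPower.

(** * Concentration of the query value, in both regimes of the tolerance *)

Section Concentration.
Variables (R : realType) (N k : nat).
Local Notation C := R[i].
Local Notation MM := (MatMeas R N).
Variables (mu : probability MM R) (O : 'M[C]_(N ^ k.+1)).
Hypotheses (N0 : (0 < N)%N) (hmu : is_haar mu) (admO : admissible O).

Local Notation Psi := (@tens_monomial R N k).
Local Notation Y := (centered k.+1 Psi O).
Local Notation mean := (limit_value k.+1 Psi O).

Let f : cpoly R N := herm_form O [:: Psi].

Definition qstat_value (U : MM) : R := complex.Re (peval f (first_col U)).

Definition deviation (t g : R) : set MM := [set U | t < `|qstat_value U - g|].

Lemma measurable_deviation t g : measurable (deviation t g).
Proof.
have mf : measurable_fun [set: MM] qstat_value by case: (cmeasurable_peval f).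
have mh : measurable_fun [set: MM] (fun U => `|qstat_value U - g|).
  apply: (measurableT_comp (@normr_measurable R setT)).
  exact: (measurable_funB mf (measurable_cst g)).
have mlt := measurable_fun_ltr (measurable_cst t) mh.
have := @mlt measurableT [set true] I.
by rewrite setTI; congr measurable; apply/seteqP; split => U.
Qed.

Lemma fail_eventE (t : R) (g : 'M[C]_(N ^ k.+1) -> R) :
  @fail_event R N k.+1 t g O = deviation t (g O).
Proof.
have [hO _] := admO.
apply/seteqP; split => U; rewrite /fail_event /deviation /= trace_ntensmx_rhoU;
  by rewrite -/f -(herm_real_Re (herm_form_real _ _ hO)) -rmorphB -/(cmod _) cmod_real.
Qed.

Let CC : R := k.+1%:R ^+ 2 / N%:R.

Let CC0 : 0 < CC.
Proof. by rewrite divr_gt0 ?exprn_gt0 ?ltr0n. Qed.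

Let st : sphere_state (haar_state mu) := haar_sphere_state N0 hmu.

Let moment p : haar_state mu (Pow Y p.*2) <= p`!%:R * (2 * CC) ^+ p.
Proof.
apply: (moment_bound N0 (ltn0Sn k) _ _ admO st).
- exact: homog_tens_monomial.
- exact: sqnorm_tens_monomial.
Qed.

Let Y_even p z : peval (Pow Y p.*2) z =
  (((complex.Re (peval f z) - mean) ^+ p.*2)%:C)%C.
Proof. by rewrite peval_Pow (peval_centered _ Psi admO) rmorphXn. Qed.

Lemma deviation_chebyshev t : 0 < t ->
  ((t ^+ 2)%:E * mu (deviation t mean) <= (2 * CC)%:E)%E.
Proof.
move=> t0; apply: (@le_trans _ _ (haar_state mu (Pow Y 1.*2))%:E); last first.
  by rewrite lee_fin (le_trans (moment 1)) // expr1 -[1`!%:R]/1 mul1r.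
apply: haar_markov => //.
- exact: measurable_deviation.
- by rewrite exprn_ge0 // ltW.
- by move=> z _; rewrite Y_even ReC sqr_ge0.
move=> U _ dU; rewrite Y_even ReC -[leRHS]real_normK ?num_real //.
by rewrite ler_pXn2r // ?nnegrE ?(ltW t0) // ltW.
Qed.

(** Markov's inequality for the exponential of [l * Y^2] with [l = 1 / (4 CC)]. Since the state is
    defined on polynomials, the series is truncated; by [moment] its [p]-th term averages to at most
    [2^(-p)], so every truncation stays below 2. *)
Lemma deviation_tail t : 0 < t ->
  ((expR (t ^+ 2 / (4 * CC)))%:E * mu (deviation t mean) <= 2%:E)%E.
Proof.
move=> t0; set A := deviation t mean.
have mA : measurable A by exact: measurable_deviation.
have muE : mu A = (fine (mu A))%:E by rewrite fineK // fin_num_measure.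
pose l : R := (4 * CC)^-1.
have l0 : 0 < l by rewrite invr_gt0 mulr_gt0.
pose P n : cpoly R N :=
  Sum (index_iota 0 n) (fun p => Mul (Cst N ((l ^+ p / p`!%:R)%:C)%C) (Pow Y p.*2)).
have cp p : 0 <= l ^+ p / p`!%:R by rewrite divr_ge0 ?exprn_ge0 // ltW.
have PE n z : complex.Re (peval (P n) z) = \sum_(p <- index_iota 0 n)
    (l ^+ p / p`!%:R) * (complex.Re (peval f z) - mean) ^+ p.*2.
  rewrite peval_Sum.
  under eq_bigr do rewrite [peval (Mul _ _) z]/= Y_even -rmorphM.
  by rewrite -real_complex_sum.
have geo n : \sum_(0 <= p < n) 2^-1 ^+ p <= 2 :> R.
  suff -> : \sum_(0 <= p < n) 2^-1 ^+ p = 2 - 2 * 2^-1 ^+ n :> R.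
    by rewrite gerBl mulr_ge0 // exprn_ge0 // invr_ge0.
  elim: n => [|n IHn]; first by rewrite big_geq // expr0; ring.
  by rewrite big_nat_recr //= IHn exprS; field.
have EP n : haar_state mu (P n) <= 2.
  rewrite (state_Sum st); apply: le_trans (geo n); apply: ler_sum => p _.
  rewrite (stateZ st) (le_trans (ler_wpM2l (cp p) (moment p))) //.
  have p0 : p`!%:R != 0 :> R by rewrite pnatr_eq0 -lt0n fact_gt0.
  rewrite mulrA divfK // -exprMn /l le_eqVlt; apply/orP; left; apply/eqP.
  by congr (_ ^+ _); field; rewrite gt_eqF.
have key n : ((series (exp_coeff (t ^+ 2 / (4 * CC))) n)%:E * mu A <= 2%:E)%E.
  have x0 : 0 <= t ^+ 2 / (4 * CC) by rewrite divr_ge0 ?sqr_ge0 // ltW // mulr_gt0.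
  apply: (@le_trans _ _ (haar_state mu (P n))%:E); last by rewrite lee_fin.
  apply: haar_markov => //.
  - by rewrite sumr_ge0 // => p _; rewrite divr_ge0 ?exprn_ge0.
  - move=> z _; rewrite PE sumr_ge0 // => p _; rewrite mulr_ge0 // -mul2n exprM.
    by rewrite exprn_ge0 // sqr_ge0.
  move=> U _ AU; rewrite PE; apply: ler_sum => p _.
  have -> : exp_coeff (t ^+ 2 / (4 * CC)) p = l ^+ p / p`!%:R * (t ^+ 2) ^+ p.
    by rewrite /exp_coeff /= exprMn -/l; move: (l ^+ p) (_ ^+ p) => a b; ring.
  rewrite ler_wpM2l //.
  rewrite -mul2n !exprM lerXn2r ?nnegrE ?sqr_ge0 // -[leRHS]real_normK ?num_real //.
  by rewrite ler_pXn2r // ?nnegrE ?(ltW t0) // ltW.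
rewrite muE -EFinM lee_fin.
have m0 : 0 <= fine (mu A) by rewrite fine_ge0.
move: m0; rewrite le_eqVlt => /orP[/eqP <-|m0]; first by rewrite mulr0.
rewrite -ler_pdivlMr //; apply: limr_le; first exact: is_cvg_series_exp_coeff.
apply: nearW => n; have := key n.
by rewrite muE -EFinM lee_fin ler_pdivlMr.
Qed.

Lemma deviation_pigeonhole t : 0 < t -> t ^+ 2 <= 5 * CC ->
  exists g, (mu (deviation t g) <= (1 - t ^+ 2 / (72 * CC))%:E)%E.
Proof.
move=> t0 t5.
(* This radius makes the Chebyshev bound [2 * CC / s ^+ 2] equal to one half. *)
pose s : R := 2 * Num.sqrt CC.
have s0 : 0 < s by rewrite mulr_gt0 // sqrtr_gt0.
have s2 : s ^+ 2 = 4 * CC by rewrite exprMn sqr_sqrtr ?(ltW CC0) //; ring.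
have tr (x : R) : 0 <= x -> (Num.truncn x)%:R <= x < (Num.truncn x).+1%:R.
  by move=> x0; exact: truncn_itv.
pose n := (Num.truncn (s / t)).+1.
have /andP[n1 n2] := tr (s / t) (ltW (divr_gt0 s0 t0)).
have snt : s < n%:R * t by rewrite -ltr_pdivrMr.
have nst : n%:R * t <= s + t.
  by move: n1; rewrite ler_pdivlMr // /n -natr1 mulrDl mul1r lerD2r.
have nR0 : (0 : R) < n%:R by rewrite ltr0n.
(* Midpoints of consecutive intervals of length [2 t] starting at [mean - s]. In the cover [F],
   index 0 is the Chebyshev event and index [i.+1] is the event of lying in interval [i]. *)
pose g (i : nat) : R := mean - s + (2 * i%:R + 1) * t.
pose F (i : nat) := if i is j.+1 then ~` deviation t (g j) else deviation s mean.
have mF i : measurable (F i).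
  by case: i => [|i] /=; [|apply: measurableC]; exact: measurable_deviation.
have cov : [set: MM] `<=` \big[setU/set0]_(i < n.+1) F i.
  move=> U _; rewrite -bigcup_mkord /=.
  have [dU|dU] := pselect (deviation s mean U); first by exists 0%N.
  move/negP: dU; rewrite -leNgt ler_norml => /andP[u1 u2].
  pose u := qstat_value U - mean + s.
  have u0 : 0 <= u by rewrite /u; lra.
  have t2 : 0 < 2 * t by rewrite mulr_gt0.
  have /andP[i1 i2] := tr (u / (2 * t)) (divr_ge0 u0 (ltW t2)).
  set i := Num.truncn (u / (2 * t)) in i1 i2.
  rewrite ler_pdivlMr // in i1; rewrite ltr_pdivrMr // -natr1 in i2.
  exists i.+1 => /=.
    rewrite ltnS -(ltr_nat R) -(ltr_pM2r t2) (le_lt_trans i1) //.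
    by rewrite /u; move: snt; lra.
  apply/negP; rewrite -leNgt ler_norml /g; rewrite /u in i1 i2.
  by apply/andP; split; lra.
have sub : (mu [set: MM] <= \sum_(i < n.+1) mu (F i))%E.
  exact: (content_subadditive mu (fun i _ => mF i) measurableT cov).
rewrite probability_setT big_ord_recl /= in sub.
have cheb : (mu (deviation s mean) <= (2^-1)%:E)%E.
  have := deviation_chebyshev s0; rewrite s2.
  have -> : mu (deviation s mean) = (fine (mu (deviation s mean)))%:E.
    by rewrite fineK // fin_num_measure //; exact: measurable_deviation.
  rewrite -EFinM !lee_fin; move: (fine _) => m h.
  by rewrite -(ler_pM2l CC0); move: h; rewrite -mulrA; move: (CC * m) => w; lra.
apply: contrapT => /forallNP noG.
pose eps : R := t ^+ 2 / (72 * CC).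
have small (i : nat) : (mu (~` deviation t (g i)) <= eps%:E)%E.
  rewrite probability_setC; last exact: measurable_deviation.
  have /negP := noG (g i); rewrite -ltNge.
  have -> : mu (deviation t (g i)) = (fine (mu (deviation t (g i))))%:E.
    by rewrite fineK // fin_num_measure //; exact: measurable_deviation.
  by rewrite -EFinB lte_fin lee_fin -/eps; lra.
(* If no midpoint works, every interval has mass at most [eps]; this is impossible since [n * eps]
   is at most [10 / 72]. *)
have : (1%:E <= (2^-1 + n%:R * eps)%:E :> \bar R)%E.
  apply: le_trans sub _; rewrite EFinD; apply: leeD => //.
  apply: (@le_trans _ _ (\sum_(i < n) eps%:E)%E).
    by apply: lee_sum => i _; exact: small.
  by rewrite sumEFin sumr_const card_ord mulr_natl.
rewrite lee_fin => h.
(* From [n t <= s + t], [2 s t <= s^2 + t^2], [s^2 = 4 CC] and [t^2 <= 5 CC]. *)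
have : n%:R * t ^+ 2 <= 10 * CC.
  have : n%:R * t * t <= (s + t) * t by rewrite ler_pM2r.
  have : 0 <= (s - t) ^+ 2 by rewrite sqr_ge0.
  rewrite sqrrB s2 expr2; rewrite expr2 in t5; move=> a b.
  rewrite mulrA; apply: le_trans b _; rewrite mulrDl.
  by move: CC0 t5 a; move: (s * t) (t * t) (CC) => p q c; lra.
have : n%:R * eps * (72 * CC) = n%:R * t ^+ 2.
  by rewrite /eps; field; rewrite gt_eqF.
have : 2^-1 * (72 * CC) <= n%:R * eps * (72 * CC).
  rewrite ler_pM2r; last by apply: mulr_gt0 => //; exact: CC0.
  by move: h; move: (n%:R * eps) => w; lra.
move=> a b c; move: CC0 a; rewrite b => c0 /le_trans/(_ c).
by move: (CC) c0 => r r0 hr; lra.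
Qed.

Lemma concentration t : 0 < t ->
  exists g, (mu (deviation t g) <= (expR (- (t ^+ 2 / (72 * CC))))%:E)%E.
Proof.
move=> t0; have [t5|t5] := leP (t ^+ 2) (5 * CC).
  have [g hg] := deviation_pigeonhole t0 t5.
  by exists g; apply: le_trans hg _; rewrite lee_fin expR_ge1Dx.
exists mean; have := deviation_tail t0.
have -> : mu (deviation t mean) = (fine (mu (deviation t mean)))%:E.
  by rewrite fineK // fin_num_measure //; exact: measurable_deviation.
rewrite -EFinM !lee_fin; set m := fine _ => h.
rewrite expRN -[leRHS]mul1r ler_pdivlMr ?expR_gt0 //.
(* The tail exponent is 18 times the target one. The spare 17 absorb the prefactor 2, because
   [17 * 5 / 72] is at least 1 and [1 + x <= expR x]. *)
have -> : t ^+ 2 / (72 * CC) = t ^+ 2 / (4 * CC) - 17 * (t ^+ 2 / (72 * CC)).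
  by field; rewrite gt_eqF.
rewrite expRB [leLHS]mulrA ler_pdivrMr ?expR_gt0 // mul1r [m * _]mulrC (le_trans h) //.
apply: le_trans (expR_ge1Dx _).
have : 5 / 72 <= t ^+ 2 / (72 * CC).
  rewrite ler_pdivlMr; last by apply: mulr_gt0 => //; exact: CC0.
  by move: (CC) t5 => c hc; lra.
by move: (t ^+ 2 / (72 * CC)) => w hw; lra.
Qed.

End Concentration.

(** * The bound on the query complexity *)

Lemma admissible0 (R : realType) n : admissible (0 : 'M[R[i]]_n).
Proof.
split; first by apply/matrixP => i j; rewrite !mxE conjc0.
move=> v; rewrite mul0mx /vnorm2 big1 ?sumr_ge0 // => i _; first exact: sqr_ge0.
by rewrite mxE ComplexField.Normc.normc0 expr0n.
Qed.

Theorem mainTheorem11 (R : realType) (N k : nat) (tau : R)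
  (hN : (0 < N)%N) (hk : (0 < k)%N) (htau : 0 < tau)
  (mu : probability (MatMeas R N) R) (hmu : is_haar mu) :
  ((expR (N%:R * tau ^+ 2 / (9 * pi ^+ 3 * k%:R ^+ 2)))%:E
     <= q_nt k tau mu)%E.
Proof.
case: k hk => // k _.
set x := N%:R * tau ^+ 2 / (9 * pi ^+ 3 * k.+1%:R ^+ 2).
pose CC : R := k.+1%:R ^+ 2 / N%:R.
have NR0 : (0 : R) < N%:R by rewrite ltr0n.
have kR0 : (0 : R) < k.+1%:R by rewrite ltr0n.
(* Since [pi] is at least 2, [9 * pi ^+ 3] is at least 72. *)
have xle : x <= tau ^+ 2 / (72 * CC).
  have -> : tau ^+ 2 / (72 * CC) = N%:R * tau ^+ 2 / (72 * k.+1%:R ^+ 2).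
    by rewrite /CC; field; rewrite -?natr1 !gt_eqF.
  rewrite /x ler_pM2l ?mulr_gt0 ?exprn_gt0 // lef_pV2 ?posrE ?mulr_gt0 ?exprn_gt0 ?pi_gt0 //.
  rewrite ler_pM2r ?exprn_gt0 //.
  have : (2 : R) ^+ 3 <= pi ^+ 3 by rewrite lerXn2r ?nnegrE ?pi_ge0 ?pi_ge2.
  have -> : (2 : R) ^+ 3 = 8 by ring.
  lra.
(* One function [g] must serve every operator; inadmissible ones get the default value 0. *)
have /choice[g hg] (O : 'M[R[i]]_(N ^ k.+1)) : exists r, admissible O ->
    (mu (deviation O tau r) <= (expR (- x))%:E)%E.
  have [aO|naO] := pselect (admissible O); last by exists 0.
  have [r hr] := concentration hN hmu aO htau; exists r => _.
  by apply: le_trans hr _; rewrite lee_fin ler_expR lerN2.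
apply: le_trans (ereal_sup_ubound _); last by exists g.
rewrite -[expR x]invrK -expRN -[X in (X <= _)%E](_ : inve (expR (- x))%:E = _); last first.
  by rewrite inver gt_eqF ?expR_gt0.
(* Inversion is used as antitone on nonnegative extended reals; the zero operator witnesses that the
   supremum is not over an empty set. *)
have sup0 : (0 <= ereal_sup [set mu (@fail_event R N k.+1 tau g O) |
    O in [set O | admissible O]])%E.
  apply: le_trans (ereal_sup_ubound _); last by exists 0 => //; exact: admissible0.
  exact: measure_ge0.
rewrite lee_pV2 ?inE ?lee_fin ?expR_ge0 //.
by apply: ub_ereal_sup => _ [Q aQ <-]; rewrite fail_eventE // hg.
Qed.
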